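(* Let $K$ be a field, $S=K[x_1,\ldots,x_n]$, and let $\Delta$ be a connected simplicial complex on $[n]=\{1,\ldots,n\}$ which is locally complete intersection. Then $S/I_\Delta$ is clean.
   Context: A simplicial complex $\Delta$ on $[n]$ is a collection of subsets of $[n]$ such that if $F\in\Delta$, then all subsets of $F$ are also in $\Delta$. Elements of $\Delta$ are called faces, and the maximal faces under inclusion are called facets. The Stanley-Reisner ideal $I_\Delta$ is the square-free monomial ideal of $S$ generated by all monomials $x_{i_1}x_{i_2}\cdots x_{i_t}$ such that $\{i_1,i_2,\ldots,i_t\}\notin\Delta$ (with $i_1,\ldots,i_t$ distinct). $\Delta$ is said to be connected if for any two facets $F$ and $G$ of $\Delta$, there exists a sequence of facets $F=F_0,F_1,\ldots,F_{q-1},F_q=G$ such that $F_i\cap F_{i+1}\neq\emptyset$ for all $0\leq i<q$. $\Delta$ is said to be locally complete intersection if $\{\{1\},\{2\},\ldots,\{n\}\}\subseteq\Delta$ and $(I_\Delta)_{\mathfrak p}$ is a complete intersection ideal of $S_{\mathfrak p}$ (i.e. generated by a regular sequence) for all $\mathfrak p\in\operatorname{Proj} S/I_\Delta$, where points of $\operatorname{Proj} S/I_\Delta$ are regarded as homogeneous prime ideals of $S$ containing $I_\Delta$ and not containing $(x_1,\ldots,x_n)$. A monomial prime ideal is a prime ideal generated by a (possibly empty) subset of the variables. For a monomial ideal $I$, the ring $S/I$ is called clean if there exists a finite chain $I=I_0\subset I_1\subset\cdots\subset I_r=S$ of monomial ideals such that $I_i/I_{i-1}\cong S/\mathfrak p_i$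 for monomial prime ideals $\mathfrak p_i$ of $S$ ($1\le i\le r$), and all the $\mathfrak p_i$ are minimal prime ideals of $I$. *)

(* Defs.v *)
From HB Require Import structures.
From mathcomp Require Import all_boot all_order all_algebra.
From mathcomp Require Import ring_quotient generic_quotient fraction.
From mathcomp Require Import boolp classical_sets mpoly.

Set Implicit Arguments.
Unset Strict Implicit.
Unset Printing Implicit Defensive.

Import GRing.Theory.

Local Open Scope ring_scope.
Local Open Scope quotient_scope.

(* An ideal of R is a submodule of the regular module R^o; it need not be     *)
(* proper.  Subsets are boolean predicates, but classical logic (boolp) turns *)
(* any property into one, so no decidability restriction is involved.         *)
Notation ideal R := (submodClosed (R%type)^o).

Section GeneratedIdeal.
Variables (R : comNzRingType) (G : set R).

Definition ideal_gen : {pred R^o} := fun x : R =>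
  `[< exists2 s : seq (R * R), (forall u, u \in s -> G u.2)
        & x = \sum_(u <- s) u.1 * u.2 >].

Fact ideal_gen_submod_closed : submod_closed ideal_gen.
Proof.
split=> [|a x y /asboolP[s Gs xE] /asboolP[t Gt yE]]; apply/asboolP.
  by exists [::]; rewrite ?big_nil.
exists ([seq (a * u.1, u.2) | u <- s] ++ t) => [u|].
  by rewrite mem_cat => /orP[/mapP[v /Gs Gv ->]|/Gt].
rewrite big_cat big_map /= xE yE; congr (_ + _).
by rewrite /GRing.scale /= mulr_sumr; apply: eq_bigr => u _; rewrite mulrA.
Qed.
HB.instance Definition _ :=
  GRing.isSubmodClosed.Build R R^o ideal_gen ideal_gen_submod_closed.
End GeneratedIdeal.

Section QuotientModule.
Variables (R : comNzRingType) (M : lmodType R) (N : submodClosed M).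

Definition submod_pred : {pred M} := fun x => x \in N.
Fact submod_pred_zmod_closed : zmod_closed submod_pred.
Proof. exact: GRing.submod_closedB (submodClosedP N). Qed.
HB.instance Definition _ :=
  GRing.isZmodClosed.Build M submod_pred submod_pred_zmod_closed.

Definition quot_mod : Type := {ideal_quot submod_pred}.
HB.instance Definition _ := GRing.Zmodule.on quot_mod.
HB.instance Definition _ := Quotient.on quot_mod.

Definition quot_scale (a : R) (x : quot_mod) : quot_mod :=
  \pi_quot_mod (a *: repr x).

Fact pi_quot_eq (u v : M) :
  (\pi_quot_mod u == \pi_quot_mod v) = (u - v \in N).
Proof. by rewrite -[RHS]/(u - v \in submod_pred) Quotient.idealrBE. Qed.

Fact pi_quot_scale a (v : M) :
  quot_scale a (\pi_quot_mod v) = \pi_quot_mod (a *: v).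
Proof.
apply/eqP; rewrite pi_quot_eq -scalerBr; apply: rpredZ.
by rewrite -pi_quot_eq reprK.
Qed.

Fact pi_quot_add (u v : M) :
  \pi_quot_mod (u + v) = \pi_quot_mod u + \pi_quot_mod v.
Proof. exact: (Quotient.pi_add submod_pred). Qed.

Fact quot_scaleA a b x : quot_scale a (quot_scale b x) = quot_scale (a * b) x.
Proof.
by elim/quotW: x => v; rewrite (pi_quot_scale b) !pi_quot_scale scalerA.
Qed.
Fact quot_scale1 : left_id 1 quot_scale.
Proof. by elim/quotW=> v; rewrite pi_quot_scale scale1r. Qed.
Fact quot_scaleDr : right_distributive quot_scale +%R.
Proof.
move=> a; elim/quotW=> u; elim/quotW=> v.
by rewrite -pi_quot_add !pi_quot_scale scalerDr pi_quot_add.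
Qed.
Fact quot_scaleDl x : {morph quot_scale^~ x : a b / a + b}.
Proof.
by move=> a b; elim/quotW: x => v; rewrite !pi_quot_scale scalerDl pi_quot_add.
Qed.
HB.instance Definition _ := GRing.Zmodule_isLmodule.Build R quot_mod
  quot_scaleA quot_scale1 quot_scaleDr quot_scaleDl.
End QuotientModule.

Section CommutativeAlgebra.
Variable R : comNzRingType.

Definition prime_ideal (p : {pred R}) : Prop :=
  idealr_closed p /\ prime_idealr_closed p.

Definition minimal_prime (I p : {pred R}) : Prop :=
  [/\ prime_ideal p, {subset I <= p} &
      forall q : {pred R}, prime_ideal q ->
        {subset I <= q} -> {subset q <= p} -> {subset p <= q}].

(* For I contained in J, the module J / I is the image of J in R / I; it is   *)
(* isomorphic to R / p iff there is an injective linear map R / p -> R / I    *)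
(* with range J / I.                                                          *)
Definition subquot_iso (J I p : ideal R) : Prop :=
  exists f : {linear quot_mod p -> quot_mod I},
    injective f /\ forall y : quot_mod I,
      (exists x, f x = y) <-> exists2 a, a \in J & y = \pi_(quot_mod I) a.

(* The empty sequence is regular and generates the zero ideal.               *)
Definition regular_seq (f : seq R) : Prop :=
  (forall (i : 'I_(size f)) (a : R),
     a * f`_i \in ideal_gen [set` take i f] -> a \in ideal_gen [set` take i f])
  /\ 1 \notin ideal_gen [set` f].

Definition complete_intersection (J : {pred R}) : Prop :=
  exists2 f : seq R, regular_seq f & J =i ideal_gen [set` f].
End CommutativeAlgebra.

(* The localization of a domain R at p, as a subring of its fraction field.   *)
Section Localization.
Variables (R : idomainType) (p : prime_idealr R).

Definition fractions_at (A : {pred R}) : {pred {fraction R}} := fun x =>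
  `[< exists2 u : R * R, u.1 \in A /\ u.2 \notin p
        & x = FracField.tofrac u.1 / FracField.tofrac u.2 >].

Definition local_pred : {pred {fraction R}} := fractions_at predT.

Fact tofrac_notin_neq0 b : b \notin p -> FracField.tofrac b != 0 :> {fraction R}.
Proof.
move=> bp; rewrite -tofrac0 tofrac_eq; apply: contraNneq bp => ->.
exact: idealr0.
Qed.

Fact local_subring_closed : subring_closed local_pred.
Proof.
have M b d : b \notin p -> d \notin p -> b * d \notin p.
  by move=> bp dp; rewrite prime_idealrM negb_or bp.
split=> [|x y|x y].
- apply/asboolP; exists (1, 1); rewrite /= ?idealr1 //.
  by rewrite tofrac1 divr1.
- move=> /asboolP[[a b] /= [_ bp] ->] /asboolP[[c d] /= [_ dp] ->].
  apply/asboolP; exists (a * d - c * b, b * d); rewrite /= ?M //.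
  have b0 := tofrac_notin_neq0 bp; have d0 := tofrac_notin_neq0 dp.
  by rewrite -mulNr addf_div // tofracB !tofracM mulNr.
- move=> /asboolP[[a b] /= [_ bp] ->] /asboolP[[c d] /= [_ dp] ->].
  apply/asboolP; exists (a * c, b * d); rewrite /= ?M //.
  by rewrite mulf_div !tofracM.
Qed.
HB.instance Definition _ :=
  GRing.isSubringClosed.Build {fraction R} local_pred local_subring_closed.

Record localization : Type :=
  Localization { local_val : {fraction R}; _ : local_val \in local_pred }.
HB.instance Definition _ := [isSub for local_val].
HB.instance Definition _ := [Choice of localization by <:].
HB.instance Definition _ :=
  [SubChoice_isSubComNzRing of localization by <:].

Definition localized_ideal (I : {pred R}) : {pred localization} :=
  fun x => local_val x \in fractions_at I.
End Localization.
Arguments localized_ideal {R} p I.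

Section SimplicialComplexes.
Variables (n : nat) (D : {set {set 'I_n}}).

Definition simplicial_complex : Prop :=
  forall F G : {set 'I_n}, F \in D -> G \subset F -> G \in D.

Definition facet (F : {set 'I_n}) : bool := maxset (mem D) F.

Definition connected_complex : Prop :=
  forall F G : {set 'I_n}, facet F -> facet G ->
    connect [rel A B | [&& facet A, facet B & A :&: B != finset.set0]] F G.
End SimplicialComplexes.

Section PolynomialIdeals.
Variables (K : fieldType) (n : nat).
Local Notation S := {mpoly K[n]}.

Definition SR_ideal (D : {set {set 'I_n}}) : ideal S :=
  ideal_gen [set f : S | exists2 F, F \notin D & f = \prod_(i in F) 'X_i].

Definition variable_ideal (A : {set 'I_n}) : ideal S :=
  ideal_gen [set f : S | exists2 i, i \in A & f = 'X_i].

Definition monomial_ideal (I : {pred S}) : Prop :=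
  exists M : set 'X_{1..n},
    I =i ideal_gen [set f : S | exists2 m, M m & f = 'X_[m]].

Definition monomial_prime (p : {pred S}) : Prop :=
  prime_ideal p /\ exists A : {set 'I_n}, p =i variable_ideal A.

Definition homogeneous_ideal (p : {pred S}) : Prop :=
  forall (f : S) (d : nat), f \in p -> pihomog mdeg d f \in p.

Definition locally_complete_intersection (D : {set {set 'I_n}}) : Prop :=
  (forall i : 'I_n, [set i]%SET \in D) /\
  forall p : prime_idealr S, homogeneous_ideal p ->
    {subset SR_ideal D <= p} ->
    ~ {subset variable_ideal [set: 'I_n]%SET <= p} ->
    complete_intersection (localized_ideal p (SR_ideal D)).

(* The inclusions in the chain are automatically strict, since each factor    *)
(* is isomorphic to the nonzero module S / p_i.                               *)
Definition clean (I : ideal S) : Prop :=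
  exists (r : nat) (J : nat -> ideal S) (p : nat -> ideal S),
    [/\ J 0%N =i I, J r =i predT,
        forall i, (i <= r)%N -> monomial_ideal (J i) &
        forall i, (i < r)%N ->
          [/\ {subset J i <= J i.+1}, subquot_iso (J i.+1) (J i) (p i),
              monomial_prime (p i) & minimal_prime I (p i)]].
End PolynomialIdeals.

(* Main.v *)
(* Localizing at the prime generated by all variables but x_v turns I_D into the ideal of the
   link of v, and there the conormal module J / J^2 is free on the minimal monomial generators:
   a syzygy between them has coefficients in J.  Two generators with a common factor have a
   syzygy violating this, so the minimal nonfaces of every vertex link are pairwise disjoint.
   Together with connectedness this forces (as in Terai and Yoshida) the minimal nonfaces of D
   itself to be pairwise disjoint, unless D is a graph.  In the first case D is vertex
   decomposable, in the second it is a connected graph; so D is shellable.  Finally, if a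
   shelling step adds the new faces [R, F] to a complex E, then I_E / I_(E u [R, F]) is generated
   by the monomial x^R, whose annihilator is the facet prime (x_j : j not in F). *)

From HB Require Import structures.
Require Import Defs.
From mathcomp Require Import all_boot all_order all_algebra.
From mathcomp Require Import ring_quotient generic_quotient fraction.
From mathcomp Require Import boolp classical_sets fintype finset mpoly.

Set Implicit Arguments.
Unset Strict Implicit.
Unset Printing Implicit Defensive.

(** * Shellings *)

Section Shellings.
Variable n : nat.
Local Notation T := 'I_n.
Implicit Types (D E : {set {set T}}) (F G H K R : {set T}) (P : pred {set T}).

Definition face_interval R F : {set {set T}} := [set G : {set T} | (R \subset G) && (G \subset F)].

(* [E] is built up by steps whose new faces form an interval [R, F]; since E is a complex,
   [R \notin E] already makes the interval disjoint from E.  Facets of different dimensions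
   are allowed. *)
Inductive shelled P : {set {set T}} -> Prop :=
| shelled0 : shelled P set0
| shelledU E R F : shelled P E -> P F -> R \subset F -> R \notin E ->
    simplicial_complex (E :|: face_interval R F) -> shelled P (E :|: face_interval R F).

(* [F \in D] is redundant for a complex; it makes the link a subset of [D] in any case. *)
Definition link D v : {set {set T}} := [set F in D | (v \notin F) && (v |: F \in D)].
Definition deletion D v : {set {set T}} := [set F in D | v \notin F].

Lemma shelled_closed P D : shelled P D -> simplicial_complex D.
Proof. by case=> // F G; rewrite inE. Qed.

Lemma shelled_sub P Q D : subpred P Q -> shelled P D -> shelled Q D.
Proof.
move=> PQ; elim=> [|E R F _ IH PF RF RE cE]; first exact: shelled0.
by apply: shelledU => //; apply: PQ.
Qed.

Lemma closed_link D v : simplicial_complex D -> simplicial_complex (link D v).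
Proof.
move=> cD F G; rewrite !inE => /and3P[FD vF vFD] GF.
rewrite (cD _ _ FD GF) (cD _ _ vFD (setUS _ GF)) andbT /=.
by apply: contra vF; apply: (subsetP GF).
Qed.

Lemma closed_deletion D v : simplicial_complex D -> simplicial_complex (deletion D v).
Proof.
move=> cD F G; rewrite !inE => /andP[FD vF] GF.
rewrite (cD _ _ FD GF) /=.
by apply: contra vF; apply: (subsetP GF).
Qed.

(** Each step [[R, F]] of [E] is replayed as [[v |: R, v |: F]]. Since [E \subset D], cone faces
    that avoid [v] are already present. *)
Lemma shelled_cone_union P D E v : simplicial_complex D -> (forall F, F \in D -> v \notin F) ->
  shelled P D -> shelled (fun F => (v \notin F) && P (v |: F)) E -> E \subset D ->
  shelled P (D :|: [set v |: F | F in E]).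
Proof.
move=> cD vD sD; elim=> [|{}E R F sE IH /andP[vF PF] RF RE cE].
  by rewrite imset0 setU0.
rewrite subUset => /andP[ED RFD].
have FD : F \in D by apply: (subsetP RFD); rewrite inE RF subxx.
have imE : [set v |: G | G in face_interval R F] = face_interval (v |: R) (v |: F).
  apply/setP=> G; apply/imsetP/idP => [[H]|].
    by rewrite !inE => /andP[RH HF] ->; rewrite !setUS.
  rewrite inE => /andP[]; rewrite subUset sub1set => /andP[vG RG] GF.
  exists (G :\ v); last by rewrite setD1K.
  rewrite inE subsetD1 RG /= -(setU1K vF) setSD // andbT.
  by apply: contra vF; apply: (subsetP RF).
have eqU : D :|: [set v |: G | G in E :|: face_interval R F] =
    (D :|: [set v |: G | G in E]) :|: face_interval (v |: R) (v |: F).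
  by rewrite imsetU imE setUA.
rewrite eqU; apply: shelledU => //; first exact: IH.
- exact: setUS.
- rewrite inE negb_or; apply/andP; split.
    by apply/negP=> /vD; rewrite setU11.
  apply/imsetP=> -[G GE eqG].
  have vG : v \notin G by apply: vD; apply: (subsetP ED).
  have vR : v \notin R by apply: contra vF; apply: (subsetP RF).
  by move/negP: RE; apply; rewrite -(setU1K vR) eqG setU1K.
- rewrite -eqU => A B; rewrite inE => /orP[AD BA|].
    by rewrite inE (cD _ _ AD BA).
  case/imsetP=> C CE -> BC.
  have [vB|vB] := boolP (v \in B); last first.
    rewrite inE (cD C) //.
      by move: CE; rewrite inE => /orP[/(subsetP ED)|/(subsetP RFD)].
    apply/subsetP=> x xB; have := subsetP BC x xB; rewrite !inE => /orP[/eqP xv|//].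
    by rewrite -xv xB in vB.
  rewrite inE; apply/orP; right; apply/imsetP; exists (B :\ v); last by rewrite setD1K.
  apply: (cE _ _ CE); apply/subsetP=> x; rewrite !inE => /andP[xv /(subsetP BC)].
  by rewrite !inE (negbTE xv).
Qed.

(** The gluing step of vertex decomposability: faces through [v] form the cone over the link and are
    added last. *)
Lemma shelled_vertex P D v : simplicial_complex D -> shelled P (deletion D v) ->
  shelled (fun F => (v \notin F) && P (v |: F)) (link D v) -> shelled P D.
Proof.
move=> cD sd sl.
suff -> : D = deletion D v :|: [set v |: F | F in link D v].
  apply: shelled_cone_union sl _ => //; first exact: closed_deletion.
    by move=> F; rewrite inE => /andP[].
  by apply/subsetP=> F; rewrite !inE => /and3P[-> ->].
apply/setP=> F; rewrite !inE; apply/idP/orP=> [FD|].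
  have [vF|vF] := boolP (v \in F); last by left; rewrite FD.
  right; apply/imsetP; exists (F :\ v); last by rewrite setD1K.
  by rewrite !inE eqxx /= setD1K // FD (cD _ _ FD (subsetDl _ _)).
by case=> [/andP[]//|/imsetP[G]]; rewrite !inE => /and3P[_ _ ?] ->.
Qed.

(** * Minimal nonfaces of links and deletions *)

Definition min_nonface D G := minset [pred F | F \notin D] G.

(** Minimal nonfaces index the minimal monomial generators of the Stanley-Reisner ideal; for
    nonempty [D] this says combinatorially that the ideal is a complete intersection. *)
Definition disjoint_nonfaces D :=
  forall G H, min_nonface D G -> min_nonface D H -> G :&: H != set0 -> G = H.

Lemma facetP D F :
  reflect (F \in D /\ forall G, G \in D -> F \subset G -> G = F) (facet D F).
Proof. exact: maxsetP. Qed.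

Lemma min_nonfaceP D G : simplicial_complex D ->
  reflect (G \notin D /\ forall x, x \in G -> G :\ x \in D) (min_nonface D G).
Proof.
move=> cD; apply: (iffP minsetP) => /= -[GD Gmin]; split=> //.
  move=> x xG; apply: contraT => GxD; have := Gmin _ GxD (subsetDl _ _).
  by move/setP/(_ x); rewrite !inE eqxx xG.
move=> H HD HG; apply/eqP; rewrite eqEsubset HG /=; apply/subsetP=> x xG.
apply: contraR HD => xH; apply: (cD _ _ (Gmin x xG)).
by rewrite subsetD1 HG.
Qed.

Lemma nonface_min D F : F \notin D -> exists2 G, min_nonface D G & G \subset F.
Proof. by move=> FD; have [G] := minset_exists (P := [pred F | F \notin D]) FD; exists G. Qed.

Lemma min_nonface_sub D G H : min_nonface D G -> H \proper G -> H \in D.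
Proof.
case/minsetP=> /= _ Gmin /properP[HG [x xG xH]].
by apply: contraT => HD; rewrite (Gmin _ HD HG) xG in xH.
Qed.

Lemma min_nonfaceN D G : min_nonface D G -> G \notin D.
Proof. by case/minsetP. Qed.

Lemma min_nonface_eq D G H : min_nonface D G -> H \notin D -> H \subset G -> H = G.
Proof. by case/minsetP=> _; apply. Qed.

(** All complexes share the vertex set ['I_n], so [v] is a one-point nonface of its own link and
    deletion; this settles that case. *)
Lemma min_nonface_singleton D v G : [set v] \notin D -> min_nonface D G -> v \in G ->
  G = [set v].
Proof. by move=> vD Gm vG; apply/esym/(min_nonface_eq Gm vD); rewrite sub1set. Qed.

Lemma link_apex D v : [set v] \notin link D v.
Proof. by rewrite !inE eqxx andbF. Qed.

Lemma deletion_vertex D v : [set v] \notin deletion D v.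
Proof. by rewrite !inE eqxx andbF. Qed.

Lemma min_nonface_deletion D v G : simplicial_complex D -> min_nonface (deletion D v) G ->
  G = [set v] \/ min_nonface D G.
Proof.
move=> cD Gm; have [vG|vG] := boolP (v \in G).
  by left; apply: min_nonface_singleton (deletion_vertex D v) Gm vG.
right; apply/min_nonfaceP=> //; split.
  by have:= min_nonfaceN Gm; rewrite !inE vG andbT.
move=> x xG; have := min_nonface_sub Gm (properD1 xG).
by rewrite inE => /andP[].
Qed.

Lemma disjoint_nonfaces_deletion D v : simplicial_complex D -> disjoint_nonfaces D ->
  disjoint_nonfaces (deletion D v).
Proof.
move=> cD ciD G H Gm Hm GH.
have vmin := min_nonface_singleton (deletion_vertex D v).
have [eqG|Gm'] := min_nonface_deletion cD Gm.
  rewrite eqG; apply/esym/vmin => //; move: GH; rewrite eqG.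
  by case/set0Pn=> x; rewrite !inE => /andP[/eqP ->].
have [eqH|Hm'] := min_nonface_deletion cD Hm; last exact: ciD.
rewrite eqH; apply/vmin => //; move: GH; rewrite eqH.
by case/set0Pn=> x; rewrite !inE => /andP[xG /eqP <-].
Qed.

(** Proper subsets of [G] stay faces of [D] after adding [v], so the obstruction is [G] itself or,
    when [G] is a face, [v |: G]. *)
Lemma min_nonface_link D v G : simplicial_complex D -> min_nonface (link D v) G -> v \notin G ->
  min_nonface D G \/ min_nonface D (v |: G).
Proof.
move=> cD Gm vG; have Gx x : x \in G -> (G :\ x \in D) && (v |: (G :\ x) \in D).
  move=> xG; have := min_nonface_sub Gm (properD1 xG).
  by rewrite inE => /and3P[-> _ ->].
have [GD|GD] := boolP (G \in D).
  right; apply/min_nonfaceP => //; split.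
    by have := min_nonfaceN Gm; rewrite !inE vG GD.
  move=> x; have [->|xv] := eqVneq x v; first by rewrite setU1K.
  rewrite 2!inE (negbTE xv) => /Gx/andP[_].
  congr (_ \in D); apply/setP=> y; rewrite !inE.
  by have [->|//] := eqVneq y v; rewrite eq_sym xv.
by left; apply/min_nonfaceP => //; split=> // x /Gx/andP[].
Qed.

Lemma disjoint_nonfaces_link D v : simplicial_complex D -> disjoint_nonfaces D ->
  disjoint_nonfaces (link D v).
Proof.
move=> cD ciD G H Gm Hm GH.
have vmin := min_nonface_singleton (link_apex D v).
have [x] := set0Pn _ GH; rewrite inE => /andP[xG xH].
have [vG|vG] := boolP (v \in G).
  move: (vmin _ Gm vG) xG => eqG; rewrite eqG inE => /eqP xv.
  by rewrite (vmin H) // -xv.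
have [vH|vH] := boolP (v \in H).
  by move: (vmin _ Hm vH) xH xG vG => -> /set1P-> ->.
have meet (A B : {set T}) : x \in A -> x \in B -> A :&: B != set0.
  by move=> xA xB; apply/set0Pn; exists x; rewrite inE xA.
have [Gm'|Gm'] := min_nonface_link cD Gm vG;
have [Hm'|Hm'] := min_nonface_link cD Hm vH.
- exact: ciD.
- have eqG : G = v |: H by apply: ciD => //; apply: meet; rewrite ?inE ?xH ?orbT.
  by rewrite eqG setU11 in vG.
- have eqH : v |: G = H by apply: ciD => //; apply: meet; rewrite ?inE ?xG ?orbT.
  by rewrite -eqH setU11 in vH.
- have eqGH : v |: G = v |: H.
    by apply: ciD => //; apply: meet; rewrite !inE ?xG ?xH ?orbT.
  by rewrite -(setU1K vG) eqGH setU1K.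
Qed.

Lemma facet_link D v F : simplicial_complex D ->
  facet (link D v) F -> (v \notin F) && facet D (v |: F).
Proof.
move=> cD /facetP[]; rewrite !inE => /and3P[FD vF vFD] Fmax.
rewrite vF; apply/facetP; split=> // G GD vFG.
have vG : v \in G by apply: (subsetP vFG); rewrite setU11.
suff -> : F = G :\ v by rewrite setD1K.
apply/esym/Fmax; first by rewrite !inE eqxx /= setD1K // GD (cD _ _ GD (subsetDl _ _)).
by rewrite subsetD1 vF andbT; apply: subset_trans vFG; apply: subsetUr.
Qed.

(** This makes [v] a shedding vertex. If [v |: F] were a face, [G] would have a point [g] outside
    it; the minimal nonface inside [g |: F] meets [G] in [g], hence equals [G] and contains [v],
    which is impossible. *)
Lemma facet_deletion D v G F : simplicial_complex D -> disjoint_nonfaces D ->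
  min_nonface D G -> v \in G -> G != [set v] -> facet (deletion D v) F -> facet D F.
Proof.
move=> cD ciD Gm vG Gv /facetP[]; rewrite !inE => /andP[FD vF] Fmax.
apply/facetP; split=> // H HD FH.
have [vH|vH] := boolP (v \in H); last by apply: Fmax; rewrite ?inE ?HD.
have [g gG gF] : exists2 g, g \in G & g \notin v |: F.
  apply/subsetPn; apply/negP => GvF; move: (min_nonfaceN Gm); apply/negP/negPn.
  apply: (cD _ _ HD); apply: subset_trans GvF _.
  by rewrite subUset sub1set vH.
have gFD : g |: F \notin D.
  apply/negP=> gFD; have : g |: F = F.
    apply: Fmax; last exact: subsetUr.
    by rewrite !inE gFD negb_or vF andbT /= eq_sym; apply: contra gF => /eqP->; rewrite setU11.
  by move/setP/(_ g); rewrite setU11 => /esym gF'; rewrite inE gF' orbT in gF.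
have [K Km KgF] := nonface_min gFD.
have gK : g \in K.
  apply: contraT => gK; move: (min_nonfaceN Km); rewrite (cD F) //.
  apply/subsetP=> x xK; have := subsetP KgF x xK; rewrite !inE => /orP[/eqP xg|//].
  by rewrite -xg xK in gK.
have eqGK : G = K by apply: ciD => //; apply/set0Pn; exists g; rewrite inE gG.
have := subsetP KgF v; rewrite -eqGK vG => /(_ isT); rewrite !inE (negbTE vF) orbF => /eqP vg.
by rewrite -vg setU11 in gF.
Qed.

Lemma card_link_deletion D v : [set v] \in D -> set0 \in D ->
  (#|link D v| < #|D|) && (#|deletion D v| < #|D|).
Proof.
move=> vD D0; apply/andP; split; apply: proper_card; apply/properP; split.
- by apply/subsetP=> F; rewrite inE => /andP[].
- by exists [set v]; last exact: link_apex.
- by apply/subsetP=> F; rewrite inE => /andP[].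
- by exists [set v]; last exact: deletion_vertex.
Qed.

Lemma disjoint_nonfaces_shelled D : simplicial_complex D -> disjoint_nonfaces D ->
  shelled (facet D) D.
Proof.
move: {2}#|D|.+1 (ltnSn #|D|) => k; elim: k D => // k IH D leDk cD ciD.
have [->|D0] := eqVneq D set0; first exact: shelled0.
have eD : set0 \in D.
  by have [F FD] := set0Pn _ D0; apply: cD FD (sub0set _).
(* A minimal nonface with at least two points supplies the shedding vertex. *)
have [/existsP[[G v] /= /and3P[Gm vG Gv]]|/existsPn Nex] :=
  boolP [exists u : {set T} * T, [&& min_nonface D u.1, u.2 \in u.1 & u.1 != [set u.2]]].
  have vD : [set v] \in D.
    by apply: (min_nonface_sub Gm); rewrite properEneq eq_sym Gv sub1set.
  have /andP[lt1 lt2] := card_link_deletion vD eD.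
  apply: (shelled_vertex cD (v := v)).
    apply: (shelled_sub (P := facet (deletion D v))).
      by move=> F; apply: facet_deletion Gm vG Gv.
    apply: IH; first exact: leq_trans lt2 leDk.
      exact: closed_deletion.
    exact: disjoint_nonfaces_deletion.
  apply: (shelled_sub (P := facet (link D v))).
    by move=> F; apply: facet_link.
  apply: IH; first exact: leq_trans lt1 leDk.
    exact: closed_link.
  exact: disjoint_nonfaces_link.
(* Now all minimal nonfaces are single points, so [D] is the full simplex on [V], shelled in one
   step. *)
pose V := [set x | [set x] \in D].
have memD F : (F \in D) = (F \subset V).
  apply/idP/idP => [FD|sF].
    by apply/subsetP=> x xF; rewrite inE (cD _ _ FD) // sub1set.
  apply: contraT => /nonface_min[G Gm GF].
  have [eG|[x xG]] := set_0Vmem G; first by move: (min_nonfaceN Gm); rewrite eG eD.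
  have := Nex (G, x); rewrite /= Gm xG negbK => /eqP eqG.
  by have := subsetP sF x (subsetP GF x xG); rewrite inE -eqG (negbTE (min_nonfaceN Gm)).
have eqD : D = set0 :|: face_interval set0 V.
  by apply/setP=> F; rewrite set0U inE sub0set memD.
rewrite [X in shelled _ X]eqD.
apply: shelledU; rewrite -?eqD ?sub0set ?inE //; first exact: shelled0.
apply/facetP; split=> [|G]; first by rewrite memD.
by rewrite memD => GV VG; apply/eqP; rewrite eqEsubset GV.
Qed.

End Shellings.

(** * Connected complexes whose links have disjoint minimal nonfaces *)

Section LocallyDisjointNonfaces.
Variables (n : nat) (D : {set {set 'I_n}}).
Local Notation T := 'I_n.
Hypothesis D_closed : simplicial_complex D.
Hypothesis D_vertex : forall x, [set x] \in D.
(** Connectedness as used below: every cut of the vertex set is crossed by an edge. *)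
Hypothesis D_crossing : forall (A : {set T}) a b, a \in A -> b \notin A ->
  exists x y, [/\ x \in A, y \notin A & [set x; y] \in D].
Implicit Types (A F G H K : {set T}) (x y z u v w a b c : T).

(** Greedy shelling of a connected graph: a partial shelling that has a vertex can be extended by an
    edge until it exhausts [D]. *)
Lemma shelled_growth E : shelled (facet D) E -> E \subset D ->
  (exists a, [set a] \in E) -> (forall F, F \in D -> #|F| <= 2) ->
  shelled (facet D) D.
Proof.
move=> sE ED Ea D2.
move: {2}(#|D| - #|E|) (erefl (#|D| - #|E|)) => k.
elim/ltn_ind: k E sE ED Ea => k IH E sE ED [a aE] eqk.
have [eqED|neqED] := eqVneq E D; first by move: sE; rewrite eqED.
have cE := shelled_closed sE.
have E0 : set0 \in E by apply: cE aE (sub0set _).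
(* Removing one point at a time is enough to check: removing two from an edge leaves the empty face,
   which is in [E]. *)
suff [R [F [RF RE FD F2 cRF]]] : exists (R F : {set T}),
    [/\ R \subset F, R \notin E, F \in D, #|F| = 2
      & forall G : {set T}, R \subset G -> G \subset F ->
        forall x, x \in G -> G :\ x \in E :|: face_interval R F].
  have FE : F \notin E by apply: contra RE => FE; apply: cE FE RF.
  have EsubU : E :|: face_interval R F \subset D.
    rewrite subUset ED; apply/subsetP=> G; rewrite inE => /andP[_ GF].
    exact: D_closed FD GF.
  apply: (IH (#|D| - #|E :|: face_interval R F|) _ (E :|: face_interval R F)) => //.
  - rewrite -eqk ltn_sub2l //; first by apply: proper_card; rewrite properEneq neqED.
    apply: proper_card; rewrite properE subsetUl /=; apply/subsetPn; exists F => //.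
    by rewrite !inE RF subxx orbT.
  - apply: shelledU => //.
      apply/facetP; split=> // G GD FG; apply/esym/eqP; rewrite eqEcard FG F2.
      exact: D2.
    move=> A B; rewrite inE => /orP[AE BA|]; first by rewrite inE (cE _ _ AE).
    rewrite inE => /andP[RA AF] BA.
    have [->|nBA] := eqVneq B A; first by rewrite !inE RA AF orbT.
    have /properP[_ [x xA xB]] : B \proper A by rewrite properEneq nBA.
    have BAx : B \subset A :\ x by rewrite subsetD1 BA.
    have := cRF A RA AF x xA; rewrite inE => /orP[/cE|]; first by rewrite inE => ->.
    rewrite inE => /andP[RAx AxF].
    have [->|nBA'] := eqVneq B (A :\ x); first by rewrite !inE RAx AxF orbT.
    have /properP[_ [y yA yB]] : B \proper A :\ x by rewrite properEneq nBA'.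
    have /eqP : #|B| = 0.
      have cA : #|A| <= 2 by rewrite -F2; apply: subset_leq_card.
      have cB : #|B| <= #|A :\ x :\ y| by apply: subset_leq_card; rewrite subsetD1 BAx.
      move: cA cB; rewrite (cardsD1 x) xA (cardsD1 y) yA.
      by case: #|_ :\ y| => [_|//]; rewrite leqn0 => /eqP.
    by rewrite cards_eq0 => /eqP->; rewrite inE E0.
  - by exists a; rewrite inE aE.
(* If a vertex is missing, some edge leads out of [E] to a new vertex [y]; the new faces are [y] and
   the edge, so [R] is [[set y]]. *)
have [/existsP[b bE]|/existsPn allE] := boolP [exists b, [set b] \notin E].
  have [x [y [xA yA xyD]]] : exists x y, [/\ x \in [set z | [set z] \in E],
      y \notin [set z | [set z] \in E] & [set x; y] \in D].
    by apply: (D_crossing (a := a) (b := b)); rewrite inE.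
  rewrite !inE in xA yA.
  have nxy : x != y by apply: contra yA => /eqP<-.
  exists [set y], [set x; y]; split=> //; first exact: subsetUr.
    by rewrite cards2 nxy.
  move=> G; rewrite sub1set => yG Gxy z zG.
  have [->|zy] := eqVneq z y.
    rewrite inE (cE _ _ xA) //; apply/subsetP=> t; rewrite !inE => /andP[ty /(subsetP Gxy)].
    by rewrite !inE (negbTE ty) orbF.
  rewrite !inE sub1set !inE eq_sym zy yG /=; apply/orP; right.
  exact: subset_trans (subsetDl _ _) Gxy.
(* With all vertices present only edges are missing, and each is added alone with [R = F]. *)
have [F FD FE] : exists2 F, F \in D & F \notin E.
  by apply/subsetPn; apply: contra neqED => DE; rewrite eqEsubset ED.
have F2 : #|F| = 2.
  apply/eqP; rewrite eqn_leq D2 // ltnNge; apply: contra FE => F1.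
  have [->//|[y yF]] := set_0Vmem F.
  have -> : F = [set y].
    by apply/esym/eqP; rewrite eqEcard sub1set yF cards1.
  by have := allE y; rewrite negbK.
exists F, F; split=> // G FG GF x xG.
have eqG : G = F by apply/eqP; rewrite eqEsubset GF.
have /eqP/cards1P[y ->] : #|G :\ x| = 1.
  by move: F2; rewrite -eqG (cardsD1 x) xG => -[].
by rewrite inE; have := allE y; rewrite negbK => ->.
Qed.

(** * Nonneighbours forced by the links *)

Hypothesis D_links : forall v, disjoint_nonfaces (link D v).

Lemma mem_link v F : (F \in link D v) = (v \notin F) && (v |: F \in D).
Proof.
rewrite inE; apply/andP/idP => [[]//|/[dup] /andP[_ vF] ->].
by rewrite (D_closed vF (subsetUr _ _)).
Qed.

Lemma min_nonface_link_in G v : min_nonface D G -> v \in G ->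
  min_nonface (link D v) (G :\ v).
Proof.
move=> Gm vG; apply/min_nonfaceP; first exact: closed_link.
rewrite mem_link !inE eqxx setD1K // (min_nonfaceN Gm); split=> // x /setD1P[xv xG].
rewrite mem_link !inE eqxx andbF /=.
suff -> : v |: G :\ v :\ x = G :\ x by apply: min_nonface_sub Gm (properD1 xG).
apply/setP=> y; rewrite !inE; have [->|_] //= := eqVneq y v.
by rewrite vG eq_sym xv.
Qed.

(** A minimal nonface of the link lying properly inside [G] is a face of [D], so it can only fail
    together with [v]. *)
Lemma min_nonface_link_notin G v : min_nonface D G -> v \notin G ->
  min_nonface (link D v) G \/ exists2 H : {set T}, H \proper G & min_nonface D (v |: H).
Proof.
move=> Gm vG; have : G \notin link D v.
  by rewrite inE (negbTE (min_nonfaceN Gm)).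
case/nonface_min=> H Hm HG.
have [<-|nHG] := eqVneq H G; first by left.
right; exists H; first by rewrite properEneq nHG.
have vH : v \notin H by apply: contra vG; apply: (subsetP HG).
case: (min_nonface_link D_closed Hm vH) => // Hm'.
by rewrite (min_nonface_eq Gm (min_nonfaceN Hm') HG) eqxx in nHG.
Qed.

(** In the link of [v] the sets [G :\ v] and [H :\ v] are minimal nonfaces, hence equal or
    disjoint. *)
Lemma min_nonface_meet G H v : min_nonface D G -> min_nonface D H -> G != H ->
  v \in G -> v \in H -> G :&: H = [set v].
Proof.
move=> Gm Hm nGH vG vH; apply/eqP/contraT => nv; case/eqP: nGH.
rewrite -(setD1K vG) -(setD1K vH); congr (_ |: _).
apply: (@D_links v); [exact: min_nonface_link_in|exact: min_nonface_link_in|].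
rewrite -setDIl; apply: contra nv; rewrite setD_eq0 => GHv.
by rewrite eqEsubset GHv sub1set inE vG.
Qed.

(** The minimal nonfaces [v |: H] and [G] meet exactly in [H], so [H] is a single point; it is
    nonempty because [v] is a vertex. *)
Lemma nonneighbour_of_subcone G H v : min_nonface D G -> v \notin G ->
  H \proper G -> min_nonface D (v |: H) -> exists2 u, u \in G & [set v; u] \notin D.
Proof.
move=> Gm vG /proper_sub/subsetP HG vHm.
have [H0|[u uH]] := set_0Vmem H.
  by move: (min_nonfaceN vHm); rewrite H0 setU0 D_vertex.
have uG := HG u uH.
exists u => //; suff -> : [set v; u] = v |: H by apply: min_nonfaceN vHm.
have nvH : v |: H != G by apply: contra vG => /eqP<-; rewrite setU11.
have := min_nonface_meet vHm Gm nvH (_ : u \in _) uG.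
rewrite !inE uH orbT => /(_ isT) meet; congr (_ |: _).
rewrite -meet setIUl (setIidPl (introT subsetP HG)).
suff -> : [set v] :&: G = set0 by rewrite set0U.
by apply/eqP; rewrite setI_eq0 disjoints1.
Qed.

(** [G] cannot be a minimal nonface of the link as well, since [K] differs from it and meets it;
    this leaves the subcone case. *)
Lemma nonneighbour_of_link_nonface G K w v : min_nonface D G -> v \notin G ->
  min_nonface (link D v) K -> K != G -> w \in K -> w \in G ->
  exists2 u, u \in G & [set v; u] \notin D.
Proof.
move=> Gm vG Km nKG wK wG.
have [Gm'|[H HG vHm]] := min_nonface_link_notin Gm vG.
  by case/eqP: nKG; apply: (D_links Km) => //; apply/set0Pn; exists w; rewrite inE wK.
exact: nonneighbour_of_subcone vHm.
Qed.

Lemma nonneighbour_one G H w v : min_nonface D G -> min_nonface D H ->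
  w \in G -> w \in H -> v \in G -> v \notin H ->
  exists2 u, u \in H & [set v; u] \notin D.
Proof.
move=> Gm Hm wG wH vG vH.
apply: (nonneighbour_of_link_nonface (K := G :\ v) (w := w)) => //.
- exact: min_nonface_link_in.
- apply/eqP=> eqGH; have := min_nonface_sub Gm (properD1 vG).
  by rewrite eqGH (negbTE (min_nonfaceN Hm)).
- by rewrite !inE wG andbT; apply: contra vH => /eqP<-.
Qed.

(** Either [G] stays minimal in the link of [v] and is played against [H], or the subcone case
    applies to [G]. *)
Lemma nonneighbour_two G H w v : min_nonface D G -> min_nonface D H -> G != H ->
  w \in G -> w \in H -> v \notin G -> v \notin H ->
  exists2 u, u \in G :|: H & [set v; u] \notin D.
Proof.
move=> Gm Hm nGH wG wH vG vH.
have [Gm'|[K KG Km]] := min_nonface_link_notin Gm vG.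
  have [u uH vu] := nonneighbour_of_link_nonface Hm vH Gm' nGH wG wH.
  by exists u; rewrite // inE uH orbT.
have [u uG vu] := nonneighbour_of_subcone Gm vG KG Km.
by exists u; rewrite // inE uG.
Qed.

Lemma pairC x y : [set x; y] = [set y; x].
Proof. exact: setUC. Qed.

Lemma min_nonface_pair x y : [set x; y] \notin D -> min_nonface D [set x; y].
Proof.
move=> xyD; apply/min_nonfaceP => //; split=> // z; rewrite !inE.
have nxy : x != y by apply: contraNneq xyD => ->; rewrite setUid.
by case/orP=> /eqP->; [rewrite setU1K ?inE|rewrite pairC setU1K ?inE // eq_sym].
Qed.

Lemma pair_in_min_nonface G x y : min_nonface D G -> 2 < #|G| -> x \in G -> y \in G ->
  [set x; y] \in D.
Proof.
move=> Gm G3 xG yG; apply: (min_nonface_sub Gm).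
rewrite properEcard subUset !sub1set xG yG; apply: leq_trans G3.
by rewrite cards2; case: eqP.
Qed.

(** * A minimal nonface with at least three points *)

Section LargeNonface.
Variable G : {set T}.
Hypotheses (G_min : min_nonface D G) (G_large : 2 < #|G|).

(** [v'] has a nonneighbour in the minimal nonface [[set v; u]], and it is not [v], since pairs
    inside [G] are faces. *)
Lemma large_nonneighbour v u v' : v \in G -> [set v; u] \notin D -> v' \in G ->
  [set v'; u] \notin D.
Proof.
move=> vG vu v'G; have [->//|nv] := eqVneq v' v.
have uG : u \notin G.
  by apply: contra vu => uG; apply: pair_in_min_nonface G_min G_large _ _.
have [||t] := @nonneighbour_one G [set v; u] v v' G_min (min_nonface_pair vu) vG _ v'G.
- by rewrite !inE eqxx.
- by rewrite !inE negb_or nv; apply: contra uG => /eqP<-.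
rewrite !inE => /orP[]/eqP-> //.
by rewrite (pair_in_min_nonface G_min G_large v'G vG).
Qed.

(* If some other minimal nonface met G, there would be a vertex joined to no vertex of G, and
   the set of all such vertices would be separated from its complement. *)
Lemma large_disjoint H : min_nonface D H -> G :&: H != set0 -> G = H.
Proof.
move=> Hm /set0Pn[w /setIP[wG wH]]; apply/eqP/contraT => nGH; exfalso.
have meet := min_nonface_meet G_min Hm nGH wG wH.
have [v vG vw] : exists2 v, v \in G & v != w.
  have [v] : exists v, v \in G :\ w.
    apply/set0Pn; rewrite -card_gt0; move: G_large; rewrite (cardsD1 w) wG.
    by case: #|_|.
  by rewrite !inE => /andP[]; exists v.
have vH : v \notin H.
  by apply: contra vw => vH; move/setP/(_ v): meet; rewrite !inE vG vH => /esym.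
have [u uH vu] := nonneighbour_one G_min Hm wG wH vG vH.
pose A := [set z | [forall g in G, [set g; z] \notin D]].
have inA g z : g \in G -> [set g; z] \notin D -> z \in A.
  move=> gG gz; rewrite inE; apply/forall_inP=> g' g'G.
  exact: large_nonneighbour gz g'G.
have uA : u \in A by apply: inA vu.
have vA : v \notin A.
  rewrite inE; apply/negP=> /forall_inP/(_ v vG); rewrite setUid.
  by rewrite D_vertex.
have [z [b [zA bA zbD]]] := D_crossing uA vA.
have zG g : g \in G -> [set g; z] \notin D.
  by move: zA; rewrite inE => /forall_inP; apply.
have bG : b \notin G by apply/negP=> /zG; rewrite pairC zbD.
have vz := zG v vG.
(* [b] misses a point of [G :|: [set v; z]]. It is joined to [z], so it misses a point of [G], which
   would put it in [A]. *)
have := @nonneighbour_two G [set v; z] v b G_min (min_nonface_pair vz).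
case.
- by apply: contraTneq G_large => ->; rewrite cards2; case: eqP.
- exact: vG.
- by rewrite !inE eqxx.
- exact: bG.
- rewrite !inE negb_or; apply/andP; split; first by apply: contraNneq bG => ->.
  by apply: contraNneq bA => ->.
move=> t; rewrite !inE => t_in bt.
have [tG|tG] := boolP (t \in G).
  by move/negP: bA; apply; apply: (inA t); rewrite // pairC.
move: t_in bt; rewrite (negbTE tG) /= => /orP[]/eqP-> bt.
  by move/negP: bA; apply; apply: (inA v); rewrite // pairC.
by rewrite pairC zbD in bt.
Qed.

(** If two others met, a point [v] of [G] would lie outside both and have a nonneighbour [u]; then
    [[set v; u]] is a minimal nonface meeting [G], so it equals [G] and is too small. *)
Lemma large_disjoint_nonfaces : disjoint_nonfaces D.
Proof.
move=> H H' Hm Hm' HH'; apply/eqP/contraT => nHH'; exfalso.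
have [v vG] : exists v, v \in G.
  by apply/set0Pn; rewrite -card_gt0; case: #|G| G_large.
have [w /setIP[wH wH']] := set0Pn _ HH'.
have nmeet K x : min_nonface D K -> x \in G -> x \in K -> G = K.
  by move=> Km xG xK; apply: large_disjoint => //; apply/set0Pn; exists x; rewrite inE xG.
have vH : v \notin H.
  apply/negP=> /(nmeet _ _ Hm vG) eqG; case/eqP: nHH'.
  by rewrite -eqG; apply: (nmeet _ w) => //; rewrite eqG.
have vH' : v \notin H'.
  apply/negP=> /(nmeet _ _ Hm' vG) eqG; case/eqP: nHH'.
  by rewrite -eqG; apply/esym/(nmeet _ w) => //; rewrite eqG.
have [u _ vu] := nonneighbour_two Hm Hm' nHH' wH wH' vH vH'.
have eqG : G = [set v; u].
  by apply: (nmeet _ v) => //; [exact: min_nonface_pair|rewrite !inE eqxx].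
by move: G_large; rewrite eqG cards2; case: eqP.
Qed.

End LargeNonface.

(** Distinct minimal nonfaces [[set a; b]] and [[set a; c]] share [a], so [z] would have a
    nonneighbour among the three points. *)
Lemma nonneighbours_matching z a b c : [set z; a] \in D -> [set z; b] \in D ->
  [set z; c] \in D -> [set a; b] \notin D -> [set a; c] \notin D -> b = c.
Proof.
move=> za zb zc ab ac; apply/eqP/contraT => nbc; exfalso.
have nz t t' : [set z; t] \in D -> [set t'; t] \notin D -> z != t'.
  by move=> zt; apply: contraNneq => <-.
have nza := nz _ _ zb ab.
have nzb : z != b by apply: (nz a) => //; rewrite pairC.
have nzc : z != c by apply: (nz a) => //; rewrite pairC.
have nab : a != b by apply: contraNneq ab => ->; rewrite setUid.
have [|||||t] := @nonneighbour_two _ _ a z (min_nonface_pair ab) (min_nonface_pair ac).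
- apply: contra nbc => /eqP/setP/(_ b); rewrite !inE eqxx orbT eq_sym (negbTE nab).
  by move=> /esym.
- by rewrite !inE eqxx.
- by rewrite !inE eqxx.
- by rewrite !inE negb_or nza.
- by rewrite !inE negb_or nza.
by rewrite !inE => /orP[]/orP[]/eqP->; rewrite ?za ?zb ?zc.
Qed.

(* The neighbours of a vertex v of a triangle form a connected graph, which makes them share
   the vertices at distance two from v: there is at most one such vertex, and no vertex is
   further away. *)
Section Triangle.
Variables v x1 x2 : T.
Hypotheses (nx12 : x1 != x2) (vx1 : [set v; x1] \in D) (vx2 : [set v; x2] \in D).
Hypothesis (x1x2 : [set x1; x2] \in D).
Hypotheses (nvx1 : v != x1) (nvx2 : v != x2).

(** Otherwise [y] would miss both [v] and [x'] among the neighbours of [x]. *)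
Lemma second_neighbour_step x x' y : [set v; y] \notin D -> [set x; v] \in D ->
  [set x; y] \in D -> [set x'; x] \in D -> x' != v -> [set x'; y] \in D.
Proof.
move=> vy xv xy x'x nx'v; apply: contraNT nx'v => x'y.
rewrite pairC in x'x; rewrite pairC in vy; rewrite pairC in x'y.
by rewrite (nonneighbours_matching xy xv x'x vy x'y).
Qed.

Lemma near_x1_or_x2 x : [set v; x] \in D -> [set x; x1] \notin D -> [set x; x2] \in D.
Proof.
move=> vx xx1; apply: contraNT nx12 => xx2.
by rewrite (nonneighbours_matching vx vx1 vx2 xx1 xx2).
Qed.

(** Adjacency to [y] spreads from [x] to [x1] and [x2], in whichever order [near_x1_or_x2]
    allows. *)
Lemma second_neighbour_x12 x y : [set v; y] \notin D -> [set x; v] \in D ->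
  [set x; y] \in D -> [set x1; y] \in D /\ [set x2; y] \in D.
Proof.
move=> vy xv xy.
have step := second_neighbour_step vy.
have [xx1|xx1] := boolP ([set x; x1] \in D).
  have x1y : [set x1; y] \in D by apply: (step x) => //; rewrite 1?pairC // eq_sym.
  by split=> //; apply: (step x1) => //; rewrite 1?pairC // eq_sym.
have xx2 : [set x; x2] \in D by apply: near_x1_or_x2; rewrite // pairC.
have x2y : [set x2; y] \in D by apply: (step x) => //; rewrite 1?pairC // eq_sym.
by split=> //; apply: (step x2) => //; rewrite 1?pairC // 1?eq_sym // pairC.
Qed.

Lemma second_neighbour_unique y y' : [set v; y] \notin D -> [set x1; y] \in D ->
  [set v; y'] \notin D -> [set x1; y'] \in D -> y = y'.
Proof.
move=> vy x1y vy' x1y'; apply: (@nonneighbours_matching x1 v) => //.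
by rewrite pairC.
Qed.

(** No edge leaves [A] from [a] to [b]. If [a] is joined to [v], then [b] is a second neighbour of
    [v], hence joined to [x1]. If not, [a] is joined to [x1] and [x2], and [b] cannot miss both, so
    [b] is again such a second neighbour. *)
Lemma triangle_diameter y : [set v; y] \notin D -> [set x1; y] \in D.
Proof.
pose A := [set y | ([set v; y] \in D) || ([set x1; y] \in D)].
suff : y \in A by rewrite inE => /orP[->|].
apply: contraT => yA; exfalso.
have vA : v \in A by rewrite inE setUid D_vertex.
have [a [b [aA bA ab]]] := D_crossing vA yA.
move: bA; rewrite inE negb_or => /andP[vb x1b].
have [va|va] := boolP ([set v; a] \in D).
  rewrite pairC in va.
  by have [] := second_neighbour_x12 vb va ab; rewrite (negbTE x1b).
have x1a : [set x1; a] \in D by move: aA; rewrite inE (negbTE va).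
have x1v : [set x1; v] \in D by rewrite pairC.
have [_ x2a] := second_neighbour_x12 va x1v x1a.
have x2b : [set x2; b] \in D.
  apply: contraNT nx12 => x2b; apply/eqP.
  apply: (@nonneighbours_matching a b); rewrite // 1?pairC //.
have x2v : [set x2; v] \in D by rewrite pairC.
by have [] := second_neighbour_x12 vb x2v x2b; rewrite (negbTE x1b).
Qed.

Lemma second_neighbour_all x y : [set v; y] \notin D -> [set v; x] \in D -> x != v ->
  [set x; y] \in D.
Proof.
move=> vy vx xv; have x1y := triangle_diameter vy.
have x1v : [set x1; v] \in D by rewrite pairC.
have [_ x2y] := second_neighbour_x12 vy x1v x1y.
have [xx1|xx1] := boolP ([set x; x1] \in D).
  by apply: (second_neighbour_step (x := x1)); rewrite // pairC.
by apply: (second_neighbour_step (x := x2)); rewrite // 1?pairC // pairC near_x1_or_x2.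
Qed.

(** A vertex not joined to [v] misses only [v], and [v] misses at most one vertex; other nonadjacent
    pairs lie among the neighbours of [v]. *)
Lemma triangle_matching a b c : [set a; b] \notin D -> [set a; c] \notin D -> b = c.
Proof.
move=> ab ac.
have eqv t t' : [set v; t] \notin D -> [set t; t'] \notin D -> t' = v.
  move=> vt tt'; apply/eqP/contraT => nt'.
  have [vt'|vt'] := boolP ([set v; t'] \in D).
    by move: tt'; rewrite pairC second_neighbour_all.
  have eqt : t = t'.
    by apply: second_neighbour_unique => //; apply: triangle_diameter.
  by rewrite eqt setUid D_vertex in tt'.
have [va|va] := boolP ([set v; a] \in D); last by rewrite (eqv a b) // (eqv a c).
have side t : [set a; t] \notin D -> [set v; t] \notin D -> a = v.
  by move=> nat vt; apply: (eqv t) => //; rewrite pairC.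
have [vb|vb] := boolP ([set v; b] \in D).
  have [vc|vc] := boolP ([set v; c] \in D).
    exact: nonneighbours_matching va vb vc ab ac.
  by rewrite (side c) // vb in ab.
have av := side b ab vb; rewrite av in ab ac.
by apply: second_neighbour_unique => //; apply: triangle_diameter.
Qed.

End Triangle.

(** Three cases: a minimal nonface with at least three points; a triangle, all minimal nonfaces
    being pairs; no triangle at all. *)
Lemma locally_disjoint_nonfaces : disjoint_nonfaces D \/ forall F, F \in D -> #|F| <= 2.
Proof.
have [/existsP[G /andP[Gm G3]]|/existsPn small] :=
  boolP [exists G, min_nonface D G && (2 < #|G|)].
  by left; apply: large_disjoint_nonfaces Gm G3.
have [/existsP[F /andP[FD F3]]|/existsPn small'] := boolP [exists F in D, 2 < #|F|]; last first.
  by right=> F FD; have := small' F; rewrite FD /= -leqNgt.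
left; have /card_gt2P[v [x1 [x2 [[vF x1F x2F] [n1 n2 n3]]]]] := F3.
have pairF x y : x \in F -> y \in F -> [set x; y] \in D.
  by move=> xF yF; apply: D_closed FD _; rewrite subUset !sub1set xF.
have match_ := @triangle_matching v x1 x2 n2 (pairF _ _ vF x1F) (pairF _ _ vF x2F)
  (pairF _ _ x1F x2F) n1 (_ : v != x2).
have pairG G a : min_nonface D G -> a \in G -> exists2 b, G = [set a; b] & [set a; b] \notin D.
  move=> Gm aG; have [b bE] : exists b, G :\ a = [set b].
    apply/cards1P; have := small G; rewrite Gm /= -leqNgt (cardsD1 a) aG.
    case: #|_| (cards_eq0 (G :\ a)) => [|[]//]; rewrite eqxx => /esym/eqP G0 _.
    by move: (min_nonfaceN Gm); rewrite -(setD1K aG) G0 setU0 D_vertex.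
  by exists b; rewrite -bE setD1K // (min_nonfaceN Gm).
move=> G H Gm Hm /set0Pn[a /setIP[/(pairG _ _ Gm)[b -> ab] /(pairG _ _ Hm)[c -> ac]]].
by rewrite (match_ _ a b c) // eq_sym.
Qed.

Lemma locally_disjoint_shelled : shelled (facet D) D.
Proof.
have [ciD|D2] := locally_disjoint_nonfaces; first exact: disjoint_nonfaces_shelled.
have [a _|T0] := pickP T; last first.
  apply: disjoint_nonfaces_shelled => // G H _ _ /set0Pn[x]; by have := T0 x.
(* The graph is shelled starting from a facet through [a]. *)
have [F FD aF] := maxset_exists (P := mem D) (D_vertex a).
have /facetP[FinD _] : facet D F by [].
apply: (shelled_growth (E := set0 :|: face_interval set0 F)) => //.
- apply: shelledU => //; [exact: shelled0|exact: sub0set|by rewrite inE|].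
  by rewrite set0U => A B; rewrite !inE !sub0set => AF BA; apply: subset_trans BA AF.
- rewrite set0U; apply/subsetP=> G; rewrite inE => /andP[_]; exact: D_closed.
- by exists a; rewrite set0U inE sub0set.
Qed.

End LocallyDisjointNonfaces.

Import GRing.Theory.
Local Open Scope ring_scope.
Local Open Scope quotient_scope.

(** * Ideals and regular sequences *)

Section Ideals.
Variable R : comNzRingType.
Implicit Types (G : set R) (I J : ideal R) (a b x y : R).

Lemma ideal_mull I a x : x \in I -> a * x \in I.
Proof. exact: (@rpredZ _ R^o I a x). Qed.

Lemma ideal_mulr I a x : x \in I -> x * a \in I.
Proof. by rewrite mulrC; apply: ideal_mull. Qed.

Lemma idealD I x y : x \in I -> y \in I -> x + y \in I.
Proof. exact: (@rpredD R^o I). Qed.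

Lemma idealB I x y : x \in I -> y \in I -> x - y \in I.
Proof. by move=> xI yI; rewrite -mulN1r; apply/idealD/ideal_mull. Qed.

Lemma ideal0 I : 0 \in I.
Proof. exact: (@rpred0 R^o I). Qed.

Lemma ideal_sum I (T : Type) (r : seq T) (P : pred T) (F : T -> R) :
  (forall i, P i -> F i \in I) -> \sum_(i <- r | P i) F i \in I.
Proof. exact: (@rpred_sum R^o I). Qed.

Lemma mem_ideal_gen G x : G x -> x \in ideal_gen G.
Proof.
move=> Gx; apply/asboolP; exists [:: (1, x)]; last by rewrite big_seq1 mul1r.
by move=> u; rewrite inE => /eqP->.
Qed.

Lemma ideal_gen_ind G (P : R -> Prop) : P 0 ->
  (forall a g x, G g -> P x -> P (a * g + x)) ->
  forall x, x \in ideal_gen G -> P x.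
Proof.
move=> P0 PS x /asboolP[s]; elim: s x => [|u s IH] x Gs ->; first by rewrite big_nil.
rewrite big_cons; apply: PS; first by apply: Gs; rewrite mem_head.
by apply: (IH _ _ erefl) => v vs; apply: Gs; rewrite inE vs orbT.
Qed.

Lemma ideal_gen_sub G I : (forall g, G g -> g \in I) -> {subset ideal_gen G <= I}.
Proof.
move=> GI; apply: ideal_gen_ind => [|a g x /GI gI xI]; first exact: ideal0.
by apply: idealD => //; apply: ideal_mull.
Qed.

Lemma ideal_gen_family (T : finType) (P : pred T) (h : T -> R) x :
  x \in ideal_gen [set g | exists2 i, P i & g = h i] ->
  exists C : T -> R, x = \sum_(i | P i) C i * h i.
Proof.
move: x; apply: ideal_gen_ind => [|a g x [i Pi ->] [C ->]].
  by exists (fun=> 0); rewrite big1 // => i _; rewrite mul0r.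
exists (fun j => C j + (if j == i then a else 0)).
under [RHS]eq_bigr do rewrite mulrDl; rewrite big_split /= addrC; congr (_ + _).
rewrite (bigD1 i) //= eqxx big1 ?addr0 // => j /andP[_ /negbTE->].
by rewrite mul0r.
Qed.

Lemma ideal_gen_seq (s : seq R) x : x \in ideal_gen [set` s] ->
  exists C : nat -> R, x = \sum_(k < size s) C k * s`_k.
Proof.
move: x; apply: ideal_gen_ind => [|a g x gs [C ->]].
  by exists (fun=> 0); rewrite big1 // => i _; rewrite mul0r.
have gs' : g \in s := gs.
have lti : (index g s < size s)%N by rewrite index_mem.
exists (fun j => C j + (if j == index g s then a else 0)).
under [RHS]eq_bigr do rewrite mulrDl; rewrite big_split /= addrC; congr (_ + _).
rewrite (bigD1 (Ordinal lti)) //= eqxx nth_index // big1 ?addr0 // => j.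
by rewrite -val_eqE /= => /negbTE->; rewrite mul0r.
Qed.

(** Induction on prefixes: regularity writes the last coefficient [a r] as a combination of the
    earlier entries with coefficients [C k], and then the [a k + C k * f_r] form a syzygy of the
    shorter prefix. *)
Lemma regular_seq_syzygy (f : seq R) (a : nat -> R) : regular_seq f ->
  \sum_(k < size f) a k * f`_k = 0 ->
  forall k, (k < size f)%N -> a k \in ideal_gen [set` f].
Proof.
case=> reg _ a0.
suff H r : (r <= size f)%N -> forall a : nat -> R, \sum_(k < r) a k * f`_k = 0 ->
    forall k, (k < r)%N -> a k \in ideal_gen [set` take r f].
  by have := H _ (leqnn _) a a0; rewrite take_size.
elim: r => {a a0}// r IH ltr a; rewrite big_ord_recr /= => a0.
have take_sub : {subset ideal_gen [set` take r f] <= ideal_gen [set` take r.+1 f]}.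
  apply: ideal_gen_sub => g /= gr; apply: mem_ideal_gen => /=.
  by rewrite (take_nth 0) // mem_rcons inE gr orbT.
have fr : f`_r \in ideal_gen [set` take r.+1 f].
  by apply: mem_ideal_gen; rewrite /= (take_nth 0) // mem_rcons mem_head.
have ar : a r \in ideal_gen [set` take r f].
  apply: (reg (Ordinal ltr)) => /=.
  have -> : a r * f`_r = - \sum_(k < r) a k * f`_k 
    by apply/eqP; rewrite -addr_eq0 addrC a0.
  rewrite -mulN1r; apply: ideal_mull; apply: ideal_sum => k _; apply/ideal_mull/mem_ideal_gen => /=.
  have ltk : (k < size (take r f))%N by rewrite size_takel // ltnW.
  by rewrite -(nth_take 0 (ltn_ord k)) mem_nth.
have [C Cr] := ideal_gen_seq ar.
rewrite size_takel ?(ltnW ltr) // in Cr.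
have Cr' : a r = \sum_(k < r) C k * f`_k.
  by rewrite Cr; apply: eq_bigr => k _; rewrite nth_take.
have IHr := IH (ltnW ltr) (fun k => a k + C k * f`_r).
move=> k; rewrite ltnS leq_eqVlt => /orP[/eqP->|ltk]; first exact: take_sub.
have -> : a k = (a k + C k * f`_r) - C k * f`_r by rewrite addrK.
apply: idealB; last exact: ideal_mull.
apply/take_sub/IHr => //; rewrite -[RHS]a0 Cr' mulr_suml -big_split /=.
by apply: eq_bigr => j _; rewrite mulrDl mulrAC.
Qed.

Lemma det_congr (m : ideal R) s (M N : 'M[R]_s) :
  (forall i j, M i j - N i j \in m) -> \det M - \det N \in m.
Proof.
move=> MN; rewrite /determinant.
apply: (big_ind2 (fun x y => x - y \in m)) => [|x1 x2 y1 y2 xm ym|s' _].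
- by rewrite subrr ideal0.
- by rewrite opprD addrACA; apply: idealD.
rewrite -mulrBr; apply: ideal_mull.
apply: (big_ind2 (fun x y => x - y \in m)) => [|x1 x2 y1 y2 xm ym|//].
  by rewrite subrr ideal0.
have -> : x1 * y1 - x2 * y2 = (x1 - x2) * y1 + x2 * (y1 - y2).
  by rewrite mulrBl mulrBr addrA subrK.
by apply: idealD; [apply: ideal_mulr|apply: ideal_mull].
Qed.

(* With m the maximal ideal of a local ring and g a minimal system of generators,
   this says that J / J^2 is free on g: if f is the regular sequence, g = B f and f = C g,
   then BC is the identity modulo m, whereas c B has entries in J by regularity. *)
Lemma complete_intersection_syzygy (J : {pred R}) (m : ideal R) s
    (g c : 'I_s -> R) :
  complete_intersection J -> (forall j, g j \in J) ->
  (forall x, x \in J -> exists C : 'I_s -> R, x = \sum_j C j * g j) ->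
  (forall d : 'I_s -> R, \sum_j d j * g j = 0 -> forall j, d j \in m) ->
  \sum_j c j * g j = 0 -> exists2 e, e - 1 \in m & forall j, e * c j \in J.
Proof.
move=> [f f_reg Jf] gJ Jg g_min cg.
have [|B B_g] := @choice _ _ (fun j (b : nat -> R) => g j = \sum_(k < size f) b k * f`_k).
  by move=> j; apply: ideal_gen_seq; rewrite -Jf.
have [|C C_f] := @choice 'I_(size f) _ (fun k (c : 'I_s -> R) => f`_k = \sum_j c j * g j).
  by move=> k; apply: Jg; rewrite Jf; apply: mem_ideal_gen; rewrite /= mem_nth.
pose Bm := \matrix_(j < s, k < size f) B j k.
pose Cm := \matrix_(k < size f, j < s) C k j.
pose cm := \row_(j < s) c j.
(* [BC] fixes [g], so the rows of [BC - 1] are syzygies of [g] and have entries in [m]. *)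
have BC_g i : \sum_j (Bm *m Cm) i j * g j = g i.
  rewrite [RHS]B_g; under [RHS]eq_bigr do rewrite C_f mulr_sumr.
  rewrite exchange_big /=; apply: eq_bigr => j _.
  by rewrite mxE mulr_suml; apply: eq_bigr => k _; rewrite !mxE mulrA.
have BC1 : \det (Bm *m Cm) - 1 \in m.
  rewrite -(det1 _ s); apply: det_congr => i j.
  apply: (g_min (fun j => (Bm *m Cm) i j - (1%:M : 'M_s) i j)).
  under eq_bigr do rewrite mulrBl; rewrite sumrB BC_g (bigD1 i) //= mxE eqxx mul1r.
  rewrite big1 ?addr0 ?subrr // => k; rewrite eq_sym => /negbTE ik.
  by rewrite mxE ik mul0r.
(* The adjugate avoids inverting [BC]: the determinant times [c] factors through [c B], whose
   entries form a syzygy of [f]. *)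
exists (\det (Bm *m Cm)) => // j.
have cB k : (cm *m Bm) 0 k \in ideal_gen [set` f].
  pose a k := \sum_j c j * B j k.
  have -> : (cm *m Bm) 0 k = a k.
    by rewrite mxE; apply: eq_bigr => i _; rewrite !mxE.
  apply: regular_seq_syzygy => //; rewrite -[RHS]cg.
  under [RHS]eq_bigr do rewrite B_g mulr_sumr.
  rewrite exchange_big /=; apply: eq_bigr => i _; rewrite mulr_suml.
  by apply: eq_bigr => t _; rewrite mulrA.
have -> : \det (Bm *m Cm) * c j = (cm *m (Bm *m Cm) *m \adj (Bm *m Cm)) 0 j.
  by rewrite -mulmxA mul_mx_adj mul_mx_scalar !mxE.
rewrite Jf mxE; apply: ideal_sum => i _; apply: ideal_mulr.
by rewrite mulmxA mxE; apply: ideal_sum => k _; apply: ideal_mulr.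
Qed.

(** Multiplication by [u] induces the isomorphism: [I : u = p] makes it well defined and injective,
    and [J = I + (u)] gives its range. *)
Lemma subquot_iso_colon (I J p : ideal R) (u : R) :
  (forall a, (a * u \in I) = (a \in p)) -> u \in J -> {subset I <= J} ->
  (forall y, y \in J -> exists a, y - a * u \in I) -> subquot_iso J I p.
Proof.
move=> colon uJ IJ Ju.
pose f (x : quot_mod p) : quot_mod I := \pi_(quot_mod I) (repr x * u : R^o).
have f_pi (a : R^o) : f (\pi_(quot_mod p) a) = \pi_(quot_mod I) (a * u : R^o).
  have ra : repr (\pi_(quot_mod p) a) - a \in p by rewrite -pi_quot_eq reprK.
  apply/eqP; rewrite pi_quot_eq -[_ \in I]/((repr (\pi_(quot_mod p) a) * u - a * u : R) \in I).
  by rewrite -mulrBl colon.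
have f_lin : linear f.
  move=> a; elim/quotW=> x; elim/quotW=> y.
  rewrite -[a *: \pi_(quot_mod p) x]/(quot_scale a _) pi_quot_scale -pi_quot_add !f_pi.
  rewrite -[a *: \pi_(quot_mod I) _]/(quot_scale a _) pi_quot_scale -pi_quot_add.
  by congr (\pi_(quot_mod I) _); rewrite mulrDl -[a *: x]/(a * x) -mulrA.
pose F : {linear quot_mod p -> quot_mod I} :=
  HB.pack f (GRing.isLinear.Build R (quot_mod p) (quot_mod I) _ f f_lin).
exists F; split.
  move=> x y; rewrite -[F x]/(f x) -[F y]/(f y).
  elim/quotW: x => x; elim/quotW: y => y; rewrite !f_pi => /eqP.
  rewrite pi_quot_eq -[_ \in I]/((x * u - y * u : R) \in I) -mulrBl colon => xy.
  by apply/eqP; rewrite pi_quot_eq.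
move=> y; split=> [[x <-]|[a aJ ->]].
  exists (repr x * u); first exact: ideal_mull.
  by [].
have [b abI] := Ju a aJ; exists (\pi_(quot_mod p) (b : R^o)).
rewrite -[F _]/(f _) f_pi; apply/eqP; rewrite eq_sym pi_quot_eq.
exact: abI.
Qed.

End Ideals.

(** * Localization *)

Section LocalizationTheory.
Variables (R : idomainType) (p : prime_idealr R).
Implicit Types (a b x y : R) (I : ideal R).

Fact tofrac_local a : FracField.tofrac a \in local_pred p.
Proof.
apply/asboolP; exists (a, 1); last by rewrite tofrac1 divr1.
by split; rewrite //= idealr1.
Qed.

Definition to_local a : localization p := Localization (tofrac_local a).

Fact to_local_zmod_morphism : zmod_morphism to_local.
Proof. by move=> a b; apply: val_inj; rewrite /= tofracB. Qed.
HB.instance Definition _ :=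
  GRing.isZmodMorphism.Build R (localization p) to_local to_local_zmod_morphism.

Fact to_local_monoid_morphism : monoid_morphism to_local.
Proof.
by split=> [|a b]; apply: val_inj; rewrite /= ?tofrac1 ?tofracM.
Qed.
HB.instance Definition _ :=
  GRing.isMonoidMorphism.Build R (localization p) to_local to_local_monoid_morphism.

Lemma to_local_inj : injective to_local.
Proof. by move=> a b /(congr1 val)/eqP; rewrite /= tofrac_eq => /eqP. Qed.

Lemma notin_primeM a b : (a * b \notin p) = (a \notin p) && (b \notin p).
Proof. by rewrite prime_idealrM negb_or. Qed.

Lemma localizationP (x : localization p) :
  exists a b, b \notin p /\ to_local b * x = to_local a.
Proof.
case: x => x xp; have /asboolP[[a b] /= [_ bp] xE] := xp.
exists a, b; split=> //; apply: val_inj; rewrite /= xE mulrC divfK //.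
exact: tofrac_notin_neq0 bp.
Qed.

Lemma localized_idealP I (x : localization p) :
  reflect (exists a b, [/\ a \in I, b \notin p & to_local b * x = to_local a])
          (x \in localized_ideal p I).
Proof.
have -> : (x \in localized_ideal p I) = (val x \in fractions_at p I) by [].
apply: (iffP idP) => [/asboolP[[a b] /= [aI bp] xE]|[a [b [aI bp xE]]]].
  exists a, b; split=> //; apply: val_inj; rewrite /= xE mulrC divfK //.
  exact: tofrac_notin_neq0 bp.
apply/asboolP; exists (a, b) => //=.
apply: (canRL (mulfK (tofrac_notin_neq0 bp))).
by rewrite mulrC; apply: (congr1 val xE).
Qed.

(* A copy of [localized_ideal] on the regular module, which can carry the submodule structure. *)
Definition extended_ideal I : {pred (localization p)^o} := localized_ideal p I.

Fact extended_ideal_submod_closed I : submod_closed (extended_ideal I).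
Proof.
split=> [|c x y /localized_idealP[a [b [aI bp xE]]] /localized_idealP[a' [b' [a'I b'p yE]]]].
  apply/localized_idealP; exists 0, 1; rewrite ideal0 idealr1.
  by rewrite mulr0 rmorph0.
have [d [e [ep cE]]] := localizationP c.
apply/localized_idealP; exists (b' * (d * a) + e * b * a'), (e * b * b').
split; first by apply: idealD; [apply/ideal_mull/ideal_mull|apply/ideal_mull].
  by rewrite !notin_primeM ep bp.
rewrite rmorphD !rmorphM /= -cE -xE -yE -[c *: x]/(c * x).
rewrite [in RHS]mulrACA [X in _ = X + _]mulrCA mulrDr.
by congr (_ + _); rewrite -!mulrA.
Qed.
HB.instance Definition _ I := GRing.isSubmodClosed.Build (localization p)
  (localization p)^o (extended_ideal I) (extended_ideal_submod_closed I).

Lemma common_denominator (T : finType) (d : T -> localization p) :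
  exists (w : R) (v : T -> R), w \notin p /\ forall k, to_local w * d k = to_local (v k).
Proof.
have [|u uE] := @choice _ _ (fun k (ab : R * R) =>
    ab.2 \notin p /\ to_local ab.2 * d k = to_local ab.1).
  by move=> k; have [a [b abE]] := localizationP (d k); exists (a, b).
exists (\prod_k (u k).2), (fun k => (\prod_(j | j != k) (u j).2) * (u k).1); split.
  apply: (big_ind (fun x => x \notin p)) => [|x y xp yp|k _].
  - by rewrite idealr1.
  - by rewrite notin_primeM xp.
  - by case: (uE k).
move=> k; rewrite (bigD1 k) //= [(u k).2 * _]mulrC !rmorphM /= -mulrA.
by case: (uE k) => _ ->.
Qed.

End LocalizationTheory.
Arguments extended_ideal {R} p I.

(** * Stanley-Reisner ideals *)

Section Restriction.
Variables (K : fieldType) (n : nat).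
Local Notation S := {mpoly K[n]}.
Implicit Types (A B F G : {set 'I_n}) (f g : S).

(* The quotient of S by the monomial prime (x_i : i \notin A), realized as a retraction of S
   onto the polynomials in the remaining variables. *)
Definition restr A : S -> S := comp_mpoly [tuple (if i \in A then 'X_i else 0) | i < n].

HB.instance Definition _ A := GRing.RMorphism.on (restr A).
HB.instance Definition _ A := GRing.Linear.on (restr A).

Definition sqfree F : S := \prod_(i in F) 'X_i.

Lemma restr_var A i : restr A 'X_i = if i \in A then 'X_i else 0.
Proof. by rewrite /restr comp_mpolyXU -tnth_nth tnth_mktuple. Qed.

Lemma sqfree_neq0 F : sqfree F != 0.
Proof.
apply/prodf_neq0 => i _; apply/eqP => /(congr1 (fun f => f@_U_(i))).
by rewrite mcoeffX eqxx mcoeff0 => /eqP; rewrite oner_eq0.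
Qed.

Lemma sqfree_split G F : G \subset F -> sqfree F = sqfree (F :\: G) * sqfree G.
Proof.
by move=> GF; rewrite /sqfree (big_setID G) /= (setIidPr GF) mulrC.
Qed.

Lemma sqfree1 i : sqfree [set i]%SET = 'X_i.
Proof. by rewrite /sqfree big_set1. Qed.

Lemma restr_sqfree A F : restr A (sqfree F) = if F \subset A then sqfree F else 0.
Proof.
rewrite rmorph_prod /=; case: ifPn => [FA|/subsetPn[i iF iA]].
  by apply: eq_bigr => i iF; rewrite restr_var (subsetP FA).
by rewrite (bigD1 i) //= restr_var (negbTE iA) mul0r.
Qed.

Lemma restr_monomial A m :
  restr A 'X_[m] = 'X_[m] \/ restr A 'X_[m] = 0.
Proof.
rewrite mpolyXE_id rmorph_prod /=.
under eq_bigr do rewrite rmorphXn /= restr_var.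
have [/existsP[i /andP[mi iA]]|/existsPn mA] := boolP [exists i, (m i != 0%N) && (i \notin A)].
  by right; rewrite (bigD1 i) //= (negbTE iA) expr0n (negbTE mi) mul0r.
left; apply: eq_bigr => i _; have := mA i; case: ifP => //= iA.
by rewrite andbT negbK => /eqP->; rewrite !expr0.
Qed.

Lemma restr_restr A B f : A \subset B -> restr A (restr B f) = restr A f.
Proof.
move=> AB; elim/mpolyind: f => [|c m f _ _ IH]; first by rewrite !rmorph0.
rewrite !rmorphD /= IH; congr (_ + _); rewrite !linearZ /=; congr (_ *: _).
rewrite mpolyXE_id !rmorph_prod; apply: eq_bigr => i _.
rewrite !rmorphXn /= !restr_var; congr (_ ^+ _).
case: ifPn => [_|iB]; first by rewrite restr_var.
by rewrite rmorph0 ifN //; apply: contra iB; apply: (subsetP AB).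
Qed.

(** As the kernel of a map into a domain, a monomial prime is visibly prime, and membership is
    tested by applying [restr A]. *)
Definition restr_ker A : {pred S} := [pred f | restr A f == 0].

Fact restr_ker_idealr A : idealr_closed (restr_ker A).
Proof.
split=> [||a f g]; rewrite ?inE ?rmorph0 ?rmorph1 ?oner_eq0 //.
by rewrite rmorphD rmorphM /= => /eqP-> /eqP->; rewrite mulr0 addr0.
Qed.

Fact restr_ker_prime A : prime_idealr_closed (restr_ker A).
Proof. by move=> f g; rewrite !inE rmorphM mulf_eq0. Qed.

HB.instance Definition _ A := isIdealr.Build S (restr_ker A) (restr_ker_idealr A).
HB.instance Definition _ A :=
  isPrimeIdealrClosed.Build S (restr_ker A) (@restr_ker_prime A).

(** [f - restr A f] always lies in the ideal of the variables outside [A]; multiplicativity reduces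
    this to single variables. *)
Lemma restr_kerE A : restr_ker A =i variable_ideal K (~: A).
Proof.
have subM x y : x - restr A x \in variable_ideal K (~: A) ->
    y - restr A y \in variable_ideal K (~: A) ->
    x * y - restr A (x * y) \in variable_ideal K (~: A).
  move=> xI yI.
  have -> : x * y - restr A (x * y) = (x - restr A x) * y + restr A x * (y - restr A y).
    by rewrite rmorphM mulrBl mulrBr addrA subrK.
  by apply: idealD; [apply: ideal_mulr|apply: ideal_mull].
have sub f : f - restr A f \in variable_ideal K (~: A).
  elim/mpolyind: f => [|c m f _ _ IH]; first by rewrite rmorph0 subr0 ideal0.
  rewrite rmorphD /= opprD addrACA; apply: idealD => //.
  rewrite linearZ /= -scalerBr -mul_mpolyC; apply: ideal_mull.
  rewrite mpolyXE_id; apply: (big_ind (fun g => g - restr A g \in _)) => [|//|i _].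
    by rewrite rmorph1 subrr ideal0.
  elim: (m i) => [|k IHk]; first by rewrite expr0 rmorph1 subrr ideal0.
  rewrite exprS; apply: subM => //.
  rewrite restr_var; case: ifPn => iA; first by rewrite subrr ideal0.
  by rewrite subr0; apply: mem_ideal_gen; exists i; rewrite ?inE.
move=> f; apply/idP/idP => [|fI].
  by rewrite inE => /eqP f0; have := sub f; rewrite f0 subr0.
rewrite inE; move: f fI; apply: ideal_gen_ind => [|a g x [i iA ->] /eqP x0].
  by rewrite rmorph0.
rewrite rmorphD rmorphM /= x0 restr_var ifN ?mulr0 ?addr0 //.
by rewrite inE in iA.
Qed.

(** [restr A] maps each monomial to itself or to zero, so it commutes with taking homogeneous
    components. *)
Lemma restr_ker_homogeneous A : homogeneous_ideal (restr_ker A).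
Proof.
move=> f d; rewrite !inE => /eqP f0.
suff -> : restr A (pihomog mdeg d f) = pihomog mdeg d (restr A f) by rewrite f0 linear0.
elim/mpolyind: f {f0} => [|c m f _ _ IH]; first by rewrite !linear0.
rewrite !linearD /= IH; congr (_ + _); rewrite !linearZ /=; congr (_ *: _).
rewrite pihomogX.
have [E|E] := restr_monomial A m; rewrite E ?linear0 ?pihomogX;
by case: (mdeg m == d); rewrite ?linear0 ?E.
Qed.

End Restriction.
Arguments restr_ker K {n} A.

Section StanleyReisner.
Variables (K : fieldType) (n : nat).
Local Notation S := {mpoly K[n]}.
Implicit Types (D E : {set {set 'I_n}}) (A B F G H R : {set 'I_n}) (f g : S).

Lemma sqfree_SR D F : F \notin D -> sqfree K F \in SR_ideal K D.
Proof. by move=> FD; apply: mem_ideal_gen; exists F. Qed.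

Lemma sqfree_dvd (I : ideal S) G F : G \subset F -> sqfree K G \in I -> sqfree K F \in I.
Proof. by move=> GF GI; rewrite (sqfree_split _ GF); apply: ideal_mull. Qed.

Lemma SR_restr D A f : simplicial_complex D -> A \in D -> f \in SR_ideal K D ->
  restr A f = 0.
Proof.
move=> cD AD; move: f; apply: ideal_gen_ind => [|a h x [F FD ->] x0]; first exact: rmorph0.
rewrite rmorphD rmorphM /= x0 addr0 restr_sqfree ifN ?mulr0 //.
by apply: contra FD; apply: cD AD.
Qed.

Lemma restr_mul_sqfree A F f : F \subset A -> restr A (f * sqfree K F) = 0 -> restr A f = 0.
Proof.
move=> FA; rewrite rmorphM /= restr_sqfree FA => /eqP.
by rewrite mulf_eq0 (negbTE (sqfree_neq0 K F)) orbF => /eqP.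
Qed.

Lemma SR_antimono D E : D \subset E -> {subset SR_ideal K E <= SR_ideal K D}.
Proof.
move=> /subsetP DE; apply: ideal_gen_sub => _ [F FE ->].
by apply: sqfree_SR; apply: contra FE; apply: DE.
Qed.

(** * Localization at a vertex *)

Section VertexLink.
Variables (D : {set {set 'I_n}}) (i : 'I_n).
Hypothesis D_complex : simplicial_complex D.

(** [p] omits only the variable of [i], which becomes a unit. [M] drops the nonface [[set i]] of the
    link; its monomials [g] minimally generate [J], and [m] is the maximal ideal. *)
Let p : prime_idealr S := restr_ker K [set i]%SET.
Let M : {set {set 'I_n}} := [set G | min_nonface (link D i) G & i \notin G].
Let g (k : 'I_#|M|) : localization p := to_local p (sqfree K (enum_val k)).
Let J := localized_ideal p (SR_ideal K D).
Let m : ideal (localization p) := extended_ideal p (variable_ideal K (~: [set i]%SET)).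

Let M_nonface G : G \in M -> i |: G \notin D.
Proof.
rewrite inE => /andP[Gm iG]; apply: contra (min_nonfaceN Gm) => iGD.
by rewrite inE iG iGD (D_complex iGD (subsetUr _ _)).
Qed.

Let M_face G H : G \in M -> H \proper G -> i |: H \in D.
Proof.
rewrite inE => /andP[Gm _] /(min_nonface_sub Gm).
by rewrite inE => /and3P[].
Qed.

Let restr_neq0 A f : i \in A -> f \notin p -> restr A f != 0.
Proof.
move=> iA; rewrite inE; apply: contra => /eqP f0.
have iA' : [set i]%SET \subset A by rewrite sub1set.
by rewrite -(restr_restr f iA') f0 rmorph0.
Qed.

Let gJ k : g k \in J.
Proof.
apply/localized_idealP; exists (sqfree K (i |: enum_val k)), ('X_i); split.
- by apply/sqfree_SR/M_nonface/enum_valP.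
- by rewrite inE restr_var set11 -sqfree1 sqfree_neq0.
- have := enum_valP k; rewrite inE => /andP[_ iG].
  by rewrite /g -rmorphM /sqfree big_setU1.
Qed.

Let SR_generated f : f \in SR_ideal K D ->
  exists C : {set 'I_n} -> S, f = \sum_(G in M) C G * sqfree K G.
Proof.
move=> fD; apply: ideal_gen_family; move: f fD; apply: ideal_gen_sub => _ [F FD ->].
have : F :\ i \notin link D i.
  rewrite inE; apply: contra FD => /and3P[_ _ iFD].
  by apply: D_complex iFD _; rewrite -subDset.
case/nonface_min=> G Gm GF.
apply: (sqfree_dvd (G := G)); first exact: subset_trans GF (subsetDl _ _).
apply: mem_ideal_gen; exists G => //; rewrite inE Gm.
by apply/negP => /(subsetP GF); rewrite !inE eqxx.
Qed.

Let Jg x : x \in J -> exists C : 'I_#|M| -> localization p, x = \sum_k C k * g k.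
Proof.
case/localized_idealP=> a [b [/SR_generated[C ->] bp xE]].
have [d dE] : exists d : localization p, to_local p b * d = 1.
  have dp : (FracField.tofrac b)^-1 \in local_pred p.
    apply/asboolP; exists (1, b); first by [].
    by rewrite tofrac1 div1r.
  exists (Localization dp); apply: val_inj; rewrite /= mulfV //.
  exact: tofrac_notin_neq0 bp.
exists (fun k => d * to_local p (C (enum_val k))).
have -> : x = d * to_local p (\sum_(G in M) C G * sqfree K G).
  by rewrite -xE mulrA [d * _]mulrC dE mul1r.
rewrite rmorph_sum mulr_sumr big_enum_val /=.
by apply: eq_bigr => k _; rewrite rmorphM mulrA.
Qed.

(** After clearing denominators, restriction to [i |: G], with [G] the [k]-th nonface, kills every
    other generator, since no other member of [M] lies inside [i |: G]; so the [k]-th coefficient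
    restricts to zero. *)
Let g_min (d : 'I_#|M| -> localization p) :
  \sum_k d k * g k = 0 -> forall k, d k \in m.
Proof.
move=> d0 k; have [w [v [wp vE]]] := common_denominator d.
have v0 : \sum_k v k * sqfree K (enum_val k) = 0.
  apply: (@to_local_inj _ p); rewrite rmorph0 -[RHS](mulr0 (to_local p w)) -[in RHS]d0.
  rewrite rmorph_sum mulr_sumr; apply: eq_bigr => j _.
  by rewrite rmorphM /= -vE mulrA.
apply/localized_idealP; exists (v k), w; split=> //.
rewrite -restr_kerE; apply: contraT => vp.
have iA : i \in i |: enum_val k by rewrite setU11.
case/eqP: (restr_neq0 iA vp); apply: (restr_mul_sqfree (F := enum_val k)).
  exact: subsetUr.
rewrite -[RHS](rmorph0 (restr (i |: enum_val k))) -v0 [in RHS](bigD1 k) //= rmorphD /=.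
rewrite [X in _ + X]rmorph_sum /= big1 ?addr0 // => j jk.
rewrite rmorphM /= restr_sqfree ifN ?mulr0 //; apply: contra jk => jk.
have := enum_valP j; have := enum_valP k; rewrite !inE => /andP[km ik] /andP[jm ij].
rewrite -(inj_eq enum_val_inj); apply/eqP/(min_nonface_eq km (min_nonfaceN jm)).
apply/subsetP => x xj; have := subsetP jk x xj.
by rewrite !inE => /orP[/eqP xi|//]; rewrite -xi xj in ij.
Qed.

Lemma lci_vertex_disjoint G H : complete_intersection J -> G \in M -> H \in M ->
  G :&: H != set0 -> G = H.
Proof.
move=> J_ci GM HM GH; apply/eqP/contraT => nGH; exfalso.
(* The syzygy cancels the two expressions of [sqfree K (G :|: H)] as multiples of the generators of
   [G] and [H]. *)
pose c F := if F == G then sqfree K (H :\: G)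
            else if F == H then - sqfree K (G :\: H) else 0.
have [|e e1 eJ] := complete_intersection_syzygy (m := m)
  (c := fun k => to_local p (c (enum_val k))) J_ci gJ Jg g_min.
  rewrite -(big_enum_val (fun F => to_local p (c F) * to_local p (sqfree K F))) /=.
  rewrite (bigD1 G) //= (bigD1 H) /= ?HM 1?eq_sym //.
  rewrite big1 => [|F /andP[/andP[_ /negbTE FG] /negbTE FH]].
    rewrite /c !eqxx eq_sym (negbTE nGH) addr0 -!rmorphM -rmorphD mulNr.
    have cup A B : sqfree K (B :\: A) * sqfree K A = sqfree K (A :|: B).
      by rewrite [RHS](sqfree_split _ (subsetUl A B)) setDUl setDv set0U.
    by rewrite !cup setUC subrr rmorph0.
  by rewrite /c FG FH rmorph0 mul0r.
have := eJ (enum_rank_in GM G); rewrite enum_rankK_in // /c eqxx.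
case/localized_idealP=> a [b [aI bp]].
have [u [w [wp ewu]]] := localizationP e.
move/(congr1 (fun x => to_local p w * x)).
rewrite mulrCA [to_local p w * (e * _)]mulrA ewu -!rmorphM.
move/to_local_inj => eq_u.
(* [e], which is [u / w], is 1 modulo [m], so its numerator stays outside [p]. *)
have up : u \notin p.
  case/localized_idealP: e1 => a' [b' [a'I b'p]].
  move/(congr1 (fun x => to_local p w * x)); rewrite mulrCA mulrBr ewu mulr1.
  rewrite -rmorphB -!rmorphM => /to_local_inj eq_a'.
  rewrite -restr_kerE in a'I.
  have : b' * (u - w) \in p by rewrite eq_a' prime_idealrM a'I orbT.
  rewrite prime_idealrM (negbTE b'p) /=; apply: contraL => up.
  by apply: contra wp => uw; rewrite -[w](subKr u) rpredB.
(* As [G] meets [H], [H :\: G] is proper in [H] and [A] is a face. Restriction to [A] kills the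
   Stanley-Reisner ideal but neither [b * u] nor the monomial of [H :\: G]. *)
pose A := i |: (H :\: G).
have AD : A \in D.
  apply: (M_face HM); rewrite properEneq subsetDl andbT.
  apply: contra GH => /eqP eqH; rewrite -eqH setIDA.
  by apply/eqP/setP=> x; rewrite !inE; case: (x \in G).
have iA : i \in A by rewrite setU11.
have bup : b * u \notin p by rewrite notin_primeM bp.
case/eqP: (restr_neq0 iA bup); apply: (restr_mul_sqfree (F := H :\: G)).
  exact: subsetUr.
rewrite -mulrA eq_u; apply: (SR_restr D_complex AD).
exact: ideal_mull.
Qed.

End VertexLink.

(** A minimal nonface through [v] is [[set v]]. The others are handled at the prime of all other
    variables, a point of Proj because it omits ['X_v]. *)
Lemma lci_link D v : simplicial_complex D -> locally_complete_intersection K D ->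
  disjoint_nonfaces (link D v).
Proof.
move=> cD [D1 lci] G H Gm Hm GH.
have vmin := min_nonface_singleton (link_apex D v).
have [x] := set0Pn _ GH; rewrite inE => /andP[xG xH].
have [vG|vG] := boolP (v \in G).
  move: (vmin _ Gm vG) xG => ->; rewrite inE => /eqP xv.
  by rewrite (vmin H) // -xv.
have [vH|vH] := boolP (v \in H).
  by move: xH xG vG; rewrite (vmin _ Hm vH) inE => /eqP-> ->.
apply: (lci_vertex_disjoint (D := D) (i := v)); rewrite ?inE ?Gm ?Hm //.
apply: lci; first exact: restr_ker_homogeneous.
  by move=> f fI; rewrite inE; apply/eqP/SR_restr/fI.
move/(_ 'X_v) => Xv; have : 'X_v \in restr_ker K [set v]%SET.
  by apply: Xv; apply: mem_ideal_gen; exists v; rewrite ?inE.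
by rewrite inE restr_var set11 -sqfree1 (negbTE (sqfree_neq0 K _)).
Qed.

(** * Shellings and clean filtrations *)

Lemma variable_ideal_prime A : prime_ideal (variable_ideal K A).
Proof.
have E := @restr_kerE K n (~: A); rewrite setCK in E.
have [[k0 k1 kA] kp] := (restr_ker_idealr K (~: A), @restr_ker_prime K n (~: A)).
split; last by move=> f g; rewrite -!E; apply: kp.
by split=> [||a f g]; rewrite -!E //; apply: kA.
Qed.

(** For [j] outside [F], the nonface [j |: F] puts ['X_j * sqfree K F] in [q]; the second factor is
    not even in the larger prime, so ['X_j] is in [q]. *)
Lemma facet_minimal_prime D F : simplicial_complex D -> facet D F ->
  minimal_prime (SR_ideal K D) (variable_ideal K (~: F)).
Proof.
move=> cD /maxsetP[FD Fmax]; split; first exact: variable_ideal_prime.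
  by move=> f fI; rewrite -restr_kerE inE; apply/eqP/SR_restr/fI.
move=> q [[q0 q1 qA] qp] Iq qF.
apply: ideal_gen_ind => [//|a g x [j jF ->] xq]; apply: qA => //.
have jFD : j |: F \notin D.
  apply/negP=> jFD; have := Fmax _ jFD (subsetUr _ _).
  by move/setP/(_ j); rewrite setU11; move: jF; rewrite inE => /negbTE->.
have : sqfree K (j |: F) \in q by apply/Iq/sqfree_SR.
rewrite inE in jF; rewrite /sqfree big_setU1 //= => /qp /orP[//|].
suff Fq A : A \subset F -> \prod_(i in A) 'X_i \notin q by rewrite (negbTE (Fq F _)).
move=> AF; apply: contra q1 => Aq.
have := qF _ Aq; rewrite -restr_kerE inE restr_sqfree AF.
by rewrite (negbTE (sqfree_neq0 K _)).
Qed.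

Lemma SR_monomial D : monomial_ideal (SR_ideal K D).
Proof.
exists (fun m => exists2 F, F \notin D & m = (\sum_(i in F) U_(i))%MM).
have E F : sqfree K F = 'X_[(\sum_(i in F) U_(i))%MM].
  by rewrite /sqfree mprodXE.
move=> f; apply/idP/idP; move: f; apply: ideal_gen_sub.
  move=> _ [F FD ->]; apply: mem_ideal_gen; exists (\sum_(i in F) U_(i))%MM; last exact: E.
  by exists F.
by move=> _ [_ [F FD ->] ->]; rewrite -E; apply: sqfree_SR.
Qed.

Lemma shelling_step E R F : simplicial_complex E -> R \subset F -> R \notin E ->
  simplicial_complex (E :|: face_interval R F) ->
  subquot_iso (SR_ideal K E) (SR_ideal K (E :|: face_interval R F)) (variable_ideal K (~: F)).
Proof.
move=> cE RF RE cU.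
have FU : F \in E :|: face_interval R F by rewrite !inE RF subxx orbT.
apply: (subquot_iso_colon (u := sqfree K R)).
- move=> a; apply/idP/idP => [aR|].
    by rewrite -restr_kerE inE; apply/eqP/(restr_mul_sqfree RF)/(SR_restr cU FU).
  move: a; apply: ideal_gen_ind => [|a h x [j jF ->] xI]; first by rewrite mul0r ideal0.
  rewrite mulrDl; apply: idealD => //; rewrite -mulrA; apply: ideal_mull.
  rewrite inE in jF; have jR : j \notin R by apply: contra jF; apply: (subsetP RF).
  have -> : 'X_j * sqfree K R = sqfree K (j |: R) by rewrite /sqfree big_setU1.
  apply: sqfree_SR; rewrite !inE negb_or subsetUr subUset sub1set (negbTE jF) andbT.
  by apply: contra RE => jRE; apply: cE jRE (subsetUr _ _).
- exact: sqfree_SR.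
- exact/SR_antimono/subsetUl.
apply: ideal_gen_ind => [|a h x [G GE ->] [b bI]].
  by exists 0; rewrite mul0r subrr ideal0.
(* A nonface of [E] containing [R] gives a multiple of [sqfree K R]; any other is still a nonface of
   the union. *)
have [RG|RG] := boolP (R \subset G).
  exists (a * sqfree K (G :\: R) + b); rewrite mulrDl -mulrA -sqfree_split //.
  by rewrite opprD addrACA subrr add0r.
exists b; rewrite -addrA; apply: idealD => //; apply/ideal_mull/sqfree_SR.
by rewrite !inE negb_or GE negb_and RG.
Qed.

Lemma shelled_clean D : simplicial_complex D -> shelled (facet D) D -> clean (SR_ideal K D).
Proof.
move=> cD.
(* The induction runs over partial complexes [E], while the primes stay minimal over the ideal of
   the whole [D]. *)
suff H E : shelled (facet D) E -> exists (r : nat) (J : nat -> ideal S) (p : nat -> ideal S),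
    [/\ J 0%N =i SR_ideal K E, J r =i predT,
        forall i, (i <= r)%N -> monomial_ideal (J i) &
        forall i, (i < r)%N ->
          [/\ {subset J i <= J i.+1}, subquot_iso (J i.+1) (J i) (p i),
              monomial_prime (p i) & minimal_prime (SR_ideal K D) (p i)]].
  exact: H.
elim=> [|{}E R F sE [r [J [p [J0 Jr J_mon J_step]]]] Ffacet RF RE cU].
  (* Without faces the ideal is [S], since the empty nonface has monomial 1; the primes are
     placeholders for a chain of length zero. *)
  exists 0%N, (fun=> SR_ideal K set0), (fun=> SR_ideal K set0).
  split=> // [f|i _]; last exact: SR_monomial.
  have /(ideal_mull f) : sqfree K set0 \in SR_ideal K (set0 : {set {set 'I_n}}).
    by apply: sqfree_SR; rewrite inE.
  by rewrite /sqfree big_set0 mulr1 => ->.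
(* Adding faces shrinks the ideal, so each shelling step is prepended to the chain. *)
exists r.+1, (fun k => if k is k'.+1 then J k' else SR_ideal K (E :|: face_interval R F)),
  (fun k => if k is k'.+1 then p k' else variable_ideal K (~: F)).
split=> // [[|i] ir|[|i] ir]; first exact: SR_monomial.
- exact: J_mon.
- split.
  + by move=> f /(SR_antimono (subsetUl _ _)); rewrite J0.
  + have [f [f_inj fE]] := shelling_step (shelled_closed sE) RF RE cU.
    exists f; split=> // y; rewrite fE; split=> -[a aJ ->]; exists a => //.
      by rewrite J0.
    by rewrite -J0.
  + by split; [exact: variable_ideal_prime|exists (~: F)].
  + exact: facet_minimal_prime.
- exact: J_step.
Qed.

(** Along a chain of facets from [a] to [b], common points of successive facets are followed inside
    [A] until one facet has points on both sides; two points of a facet form a face. *)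
Lemma connected_crossing D : simplicial_complex D -> connected_complex D ->
  (forall i, [set i]%SET \in D) ->
  forall (A : {set 'I_n}) a b, a \in A -> b \notin A ->
  exists x y, [/\ x \in A, y \notin A & [set x; y]%SET \in D].
Proof.
move=> cD Dconn D1 A a b aA bA.
have facet_over i : exists2 F, facet D F & i \in F.
  have [F FD] := maxset_exists (P := mem D) (D1 i).
  by rewrite sub1set => iF; exists F.
have face_pair F x y : facet D F -> x \in F -> y \in F -> [set x; y]%SET \in D.
  move=> /maxsetP[FD _] xF yF; apply: (cD F) => //.
  by rewrite subUset !sub1set xF.
have [F F_facet aF] := facet_over a; have [G G_facet bG] := facet_over b.
have /connectP[s] := Dconn F G F_facet G_facet.
elim: s F a aA F_facet aF => [|H s IH] F x xA F_facet xF /=.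
  by move=> _ eqFG; exists x, b; split=> //; apply: (face_pair F); rewrite // -eqFG.
move=> /andP[/and3P[_ H_facet /set0Pn[y /setIP[yF yH]]] Hs] Gs.
have [yA|yA] := boolP (y \in A); first exact: (IH H y).
by exists x, y; split=> //; apply: (face_pair F).
Qed.

End StanleyReisner.

Theorem lemma2p8 (K : fieldType) (n : nat) (D : {set {set 'I_n}})
    (D_complex : simplicial_complex D) (D_connected : connected_complex D)
    (D_lci : locally_complete_intersection K D) :
  clean (SR_ideal K D).
Proof.
have [D1 _] := D_lci.
apply: shelled_clean => //; apply: locally_disjoint_shelled => //.
- exact: connected_crossing.
- by move=> v; apply: lci_link D_lci.
Qed.
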